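(* Let $E\subset\mathbb{R}^N$ be open, $p>1$ and $\gamma>0$. Let $u\in[DG]_p^-(E;\gamma)$ be non-negative and bounded above by some positive constant $M$. Then $$\int_{K_\rho(y)}|D\ln u|^p\,dx\le\frac{\gamma p}{(R-\rho)^p}\int_{K_R(y)}\ln\frac{M}{u}\,dx$$ for any pair of cubes $K_\rho(y)\subset K_R(y)\subset E$.
   Context: For $y\in\mathbb{R}^N$ and $\rho>0$, $K_\rho(y)$ denotes the (axis-parallel) cube of edge $2\rho$ centered at $y$. Pairs of cubes $K_\rho(y)\subset K_R(y)$ have $0<\rho<R$. For a function $w$, $w_-=\max\{-w,0\}$; $D$ denotes the weak gradient. Here $D\ln u=Du/u$, and $\ln(M/u)=+\infty$ where $u=0$ (so the right-hand side may be $+\infty$). DeGiorgi class: for $p>1$ and a constant $\gamma>0$, $[DG]_p^{-}(E;\gamma)$ is the collection of functions $u\in W^{1,p}_{\mathrm{loc}}(E)$ such that $$\int_{K_\rho(y)}|D(u-k)_-|^p\,dx\le\frac{\gamma}{(R-\rho)^p}\int_{K_R(y)}|(u-k)_-|^p\,dx$$ for all cubes $K_\rho(y)\subset K_R(y)\subset E$ and all $k\in\mathbb{R}$. *)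

(* Defs.v *)
From HB Require Import structures.
From mathcomp Require Import all_boot all_order all_algebra.
From mathcomp Require Import all_classical all_reals all_analysis.

Set Implicit Arguments.
Unset Strict Implicit.
Unset Printing Implicit Defensive.
Import Order.TTheory GRing.Theory Num.Theory.
Import numFieldNormedType.Exports.

Local Open Scope classical_set_scope.
Local Open Scope ring_scope.

(* Row vectors carry the sup norm in mathcomp-analysis, but no sigma-algebra:
   we equip them with the Borel one. *)
Section borel_rV.
Context {R : realType} {n : nat}.

Let borel : set (set 'rV[R]_n) := <<s @open 'rV[R]_n >>.

Let borel0 : borel set0. Proof. exact: sigma_algebra0. Qed.

Let borelC A : borel A -> borel (~` A). Proof. exact: sigma_algebraC. Qed.

Let borel_bigcup (F : (set 'rV[R]_n)^nat) :
  (forall i, borel (F i)) -> borel (\bigcup_i (F i)).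
Proof. exact: sigma_algebra_bigcup. Qed.

HB.instance Definition _ := @isMeasurable.Build
  (sigma_display (@open 'rV[R]_n)) 'rV[R]_n borel borel0 borelC borel_bigcup.

Lemma open_measurable_rV (U : set 'rV[R]_n) : open U -> measurable U.
Proof. exact: sub_sigma_algebra. Qed.

Definition rV_of_tuple (t : n.-tuple (measurableTypeR R)) : 'rV[R]_n := \row_i tnth t i.

Lemma measurable_rV_of_tuple : measurable_fun [set: n.-tuple (measurableTypeR R)] rV_of_tuple.
Proof.
pose B (z : 'rV[rat]_n * rat) : set 'rV[R]_n :=
  [set x | forall i, `|x 0 i - ratr (z.1 0 i)| < ratr z.2].
have mB z : measurable (rV_of_tuple @^-1` B z).
  have -> : rV_of_tuple @^-1` B z = \bigcap_(i in [set: 'I_n])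
      ((@tnth n R ^~ i) @^-1`
        `]ratr (z.1 0 i) - ratr z.2, ratr (z.1 0 i) + ratr z.2[%classic).
    apply/seteqP; split => [t Bt i _|t Bt i].
      by have := Bt i; rewrite /= !mxE ltr_distl in_itv.
    by have := Bt i I; rewrite /= !mxE ltr_distl in_itv.
  apply: fin_bigcap_measurable; first exact: finite_finset.
  by move=> i _; rewrite -[X in measurable X]setTI; exact: measurable_tnth.
apply: (@measurability _ _ _ _ _ rV_of_tuple (@open 'rV[R]_n)) => //.
move=> _ [U oU <-]; rewrite setTI.
have -> : U = \bigcup_(z in [set z | B z `<=` U]) B z.
  apply/seteqP; split => [x Ux|x [z /= zU]]; last exact: zU.
  have [e /= e0 xeU] := open_subball oU Ux.
  pose d := e / 4%:R.
  have d0 : 0 < d by rewrite divr_gt0.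
  have d2 : d < d *+ 2 by rewrite mulr2n ltrDl.
  have [q] := rat_in_itvoo d2; rewrite in_itv/= => /andP[dq qd].
  have /choice[c cP] : forall i, exists c : rat, `|x 0 i - ratr c| < d.
    move=> i; have xd : x 0 i - d < x 0 i + d by rewrite ltrD2l gtrN.
    have [c] := rat_in_itvoo xd.
    by rewrite in_itv/= => xc; exists c; rewrite distrC ltr_distl.
  exists (\row_i c i, q) => /=; last first.
    by move=> i; rewrite /= mxE (lt_trans (cP i)).
  move=> w Bw; apply: (xeU (d *+ 3)) => /=.
  - rewrite sub0r normrN gtr0_norm ?mulrn_wgt0// /d.
    by rewrite -mulr_natr -mulrA gtr_pMr// mulrC ltr_pdivrMr// mul1r ltr_nat.
  - by rewrite mulrn_wgt0.
  - split; first by rewrite mulrn_wgt0.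
    move=> i j; rewrite (ord1 i).
    have := Bw j; rewrite /= mxE => wj.
    have := ler_distD (ratr (c j)) (x 0 j) (w 0 j) => /le_lt_trans; apply.
    by rewrite mulrSr addrC ltrD// distrC (lt_trans wj).
rewrite preimage_bigcup bigcup_mkcond.
apply: countable_bigcupT_measurable => //= z.
by case: ifP => _ //; exact: mB.
Qed.

End borel_rV.

(* Lebesgue measure on R^n: the n-fold product of lebesgue_measure, built on
   tuples (for which the library has a product sigma-algebra) and transported
   to row vectors; lebesgue_rV_box gives the volume of boxes. *)
Section lebesgue_rV.
Context {R : realType}.
Local Open Scope ereal_scope.
Local Notation T := (measurableTypeR R).

Section step.
Context {n : nat} (mu : {sigma_finite_measure set (n.-tuple T) -> \bar R}).

Definition tcons (z : T * n.-tuple T) : n.+1.-tuple T := [tuple of z.1 :: z.2].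

Lemma measurable_tcons : measurable_fun setT tcons.
Proof. exact: measurable_cons. Qed.

Definition lebesgue_step : set (n.+1.-tuple T) -> \bar R :=
  pushforward (@lebesgue_measure R \x mu) tcons.

Let pf : {measure set (n.+1.-tuple T) -> \bar R} :=
  measure_function_pushforward__canonical__measure_function_Measure
    (@lebesgue_measure R \x mu) measurable_tcons.

HB.instance Definition _ := isMeasure.Build _ _ _ lebesgue_step
  (measure0 pf) (measure_ge0 pf) (@measure_semi_sigma_additive _ _ _ pf).

Let lebesgue_step_sigma_finite : sigma_finite setT lebesgue_step.
Proof.
have /sigma_finiteP[F [FT ndF Foo]] := sigma_finiteT (@lebesgue_measure R).
have /sigma_finiteP[G [GT ndG Goo]] := sigma_finiteT mu.
pose uncons (t : n.+1.-tuple T) : T * n.-tuple T := (thead t, [tuple of behead t]).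
have muncons : measurable_fun setT uncons.
  apply: measurable_fun_pair; first exact: measurable_tnth.
  exact: measurable_behead.
exists (fun i => uncons @^-1` (F i `*` G i)).
  apply/esym; rewrite -preimage_bigcup -(@preimage_setT _ _ uncons).
  congr (_ @^-1` _); apply/seteqP; split=> // -[x t] _.
  have [i _ Fx] : (\bigcup_k F k) x by rewrite -FT.
  have [j _ Gt] : (\bigcup_k G k) t by rewrite -GT.
  exists (maxn i j) => //; split => /=.
  - by move: x Fx; exact/subsetPset/ndF/leq_maxl.
  - by move: t Gt; exact/subsetPset/ndG/leq_maxr.
move=> i; have [mF Fi] := Foo i; have [mG Gi] := Goo i; split.
  by rewrite -[X in measurable X]setTI; apply: muncons => //; exact: measurableX.
rewrite /lebesgue_step /pushforward.
rewrite (_ : tcons @^-1` _ = F i `*` G i).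
  by rewrite product_measure1E// lte_mul_pinfty// ge0_fin_numE.
apply/seteqP; split=> -[x t] /=; rewrite theadE (_ : [tuple of _] = t) //;
  exact/val_inj.
Qed.

HB.instance Definition _ := Measure_isSigmaFinite.Build _ _ _ lebesgue_step
  lebesgue_step_sigma_finite.

End step.

Fixpoint lebesgue_tuple n : {sigma_finite_measure set (n.-tuple T) -> \bar R} :=
  match n with
  | 0%N => \d_([tuple] : 0.-tuple T)
  | m.+1 => lebesgue_step (lebesgue_tuple m)
  end.

Lemma lebesgue_tuple_box n (a b : 'I_n -> R) : (forall i, (a i <= b i)%R) ->
  lebesgue_tuple n [set t | forall i, tnth t i \in `]a i, b i[] =
  (\prod_i (b i - a i))%:E.
Proof.
elim: n a b => [|n ih] a b ab.
  by rewrite big_ord0 /= diracE mem_set// => -[].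
rewrite big_ord_recl /= /lebesgue_step /pushforward.
pose B := [set t : n.-tuple T |
  forall i, tnth t i \in `]a (lift ord0 i), b (lift ord0 i)[].
rewrite (_ : _ @^-1` _ = `]a ord0, b ord0[%classic `*` B); last first.
  apply/seteqP; split=> -[x t] /=.
    move=> H; split=> [|i]; first by have := H ord0; rewrite tnth0.
    by have := H (lift ord0 i); rewrite tnthS.
  move=> [xab Bt] i; case: (unliftP ord0 i) => [j ->|->].
    by rewrite tnthS.
  by rewrite tnth0.
have mB : measurable B.
  rewrite (_ : B = \bigcap_(i in [set: 'I_n]) ((@tnth n T ^~ i) @^-1`
      `]a (lift ord0 i), b (lift ord0 i)[%classic)).
    apply: fin_bigcap_measurable; first exact: finite_finset.
    by move=> i _; rewrite -[X in measurable X]setTI; exact: measurable_tnth.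
  by apply/seteqP; split=> [t Bt i _|t Bt i]; [exact: Bt|exact: (Bt i I)].
rewrite product_measure1E// ih//.
rewrite [X in X * _](lebesgue_measure_itv `]a ord0, b ord0[)/= lte_fin EFinM.
congr (_ * _); have := ab ord0; rewrite le_eqVlt => /predU1P[->|->//].
by rewrite ltxx subrr.
Qed.

Section rV.
Context {n : nat}.
Local Open Scope ring_scope.

Definition lebesgue_rV : set 'rV[R]_n -> \bar R :=
  pushforward (lebesgue_tuple n) (@rV_of_tuple R n).

Let pf : {measure set 'rV[R]_n -> \bar R} :=
  measure_function_pushforward__canonical__measure_function_Measure
    (lebesgue_tuple n) measurable_rV_of_tuple.

HB.instance Definition _ := isMeasure.Build _ _ _ lebesgue_rV
  (measure0 pf) (measure_ge0 pf) (@measure_semi_sigma_additive _ _ _ pf).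

Lemma lebesgue_rV_box (a b : 'rV[R]_n) : (forall i, a 0 i <= b 0 i) ->
  lebesgue_rV [set x | forall i, x 0 i \in `]a 0 i, b 0 i[] =
  (\prod_i (b 0 i - a 0 i))%:E.
Proof.
move=> ab; rewrite -lebesgue_tuple_box// /lebesgue_rV /pushforward.
by congr (lebesgue_tuple n _); apply/seteqP; split=> t /= H i;
  have := H i; rewrite mxE.
Qed.

Let lebesgue_rV_sigma_finite : sigma_finite setT lebesgue_rV.
Proof.
exists (fun k => ball (0 : 'rV[R]_n) k.+1%:R) => [|k].
  apply/esym; rewrite -subTset => x _.
  exists (Num.truncn `|x|) => //; rewrite -ball_normE /= sub0r normrN.
  exact: truncnS_gt.
split; first by apply: open_measurable_rV; exact: ball_open.
rewrite (_ : ball _ _ = [set x : 'rV[R]_n | forall i,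
    x 0 i \in `](const_mx (- k.+1%:R) : 'rV[R]_n) 0 i,
                 (const_mx k.+1%:R : 'rV[R]_n) 0 i[]).
  rewrite lebesgue_rV_box ?ltry// => i; rewrite !mxE.
  by rewrite (@le_trans _ _ 0)// oppr_le0.
apply/seteqP; split=> x /=.
  by move=> [_ H] i; have := H 0 i; rewrite !mxE /ball/= sub0r normrN ltr_norml in_itv.
move=> H; split=> // i j; rewrite (ord1 i) !mxE /ball/= sub0r normrN ltr_norml.
by have := H j; rewrite !mxE in_itv.
Qed.

HB.instance Definition _ := Measure_isSigmaFinite.Build _ _ _ lebesgue_rV
  lebesgue_rV_sigma_finite.

End rV.
End lebesgue_rV.

Section degiorgi.
Context {R : realType} {N : nat}.
Local Notation V := 'rV[R]_N.
Local Notation mu := (@lebesgue_rV R N).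
Implicit Types (E : set V) (f u phi : V -> R) (p gamma rho r : R).

(* `|v| is the sup norm on 'rV[R]_N; gradients are measured by the Euclidean one. *)
Definition enorm (v : V) : R := Num.sqrt (\sum_i v 0 i ^+ 2).

Definition cube (y : V) r : set V := [set x | forall i, `|x 0 i - y 0 i| < r].

Definition partial (i : 'I_N) f : V -> R := fun x => 'D_(delta_mx 0 i) f x.

Definition smooth f := forall s : seq 'I_N, let g := foldr partial f s in
  continuous g /\ forall x i, derivable g x (delta_mx 0 i).

(* C_c^oo(E), its elements being extended by 0 to the whole space *)
Definition test_function E phi :=
  let K := closure [set x | phi x != 0] in
  [/\ smooth phi, compact K & K `<=` E].

Definition Lploc p E f := measurable_fun E f /\
  forall K, compact K -> K `<=` E ->
    (\int[mu]_(x in K) (`|f x| `^ p)%:E < +oo)%E.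

Definition is_weak_gradient E u (g : V -> V) :=
  [/\ Lploc 1 E u, forall i, Lploc 1 E (fun x => g x 0 i) &
    forall phi, test_function E phi -> forall i,
      \int[mu]_(x in E) (u x * partial i phi x) =
      - \int[mu]_(x in E) (g x 0 i * phi x)].

(* weakly differentiable functions have an a.e. unique weak gradient; the
   value is 0 when there is none *)
Definition weak_gradient E u : V -> V :=
  xget (fun=> 0) [set g | is_weak_gradient E u g].

Definition W1ploc p E u := [/\ Lploc p E u,
  exists g, is_weak_gradient E u g &
  forall i, Lploc p E (fun x => weak_gradient E u x 0 i)].

Definition DGminus p E gamma u := W1ploc p E u /\
  forall y rho r k, 0 < rho -> rho < r -> cube y r `<=` E ->
    (\int[mu]_(x in cube y rho)
        (enorm (weak_gradient E ((u \- cst k)^\-) x) `^ p)%:E <=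
     (gamma / (r - rho) `^ p)%:E *
       \int[mu]_(x in cube y r) (`|(u \- cst k)^\- x| `^ p)%:E)%E.

End degiorgi.

(* Main.v *)
Require Import Defs.
From HB Require Import structures.
From mathcomp Require Import all_boot all_order all_algebra.
From mathcomp Require Import all_classical all_reals all_analysis.
From mathcomp Require Import measurable_realfun.
From mathcomp Require finmap.
From mathcomp Require Import ring lra.
Set Implicit Arguments.
Unset Strict Implicit.
Unset Printing Implicit Defensive.
Import Order.TTheory GRing.Theory Num.Theory.
Import numFieldNormedType.Exports.

Local Open Scope classical_set_scope.
Local Open Scope ring_scope.

(** The logarithm is a superposition of truncations. Multiply the De Giorgi
    estimate at level [k] by [p * k^(-p-1)], integrate over [k] in ]0, M[, and
    add [M^(-p)] times the estimate at the level [M]. Since the gradient of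
    [(u - k)_-] is that of [- u] where [u <= k] and zero elsewhere, Tonelli's
    theorem turns the left-hand side into the integral of [|Du|^p] against the
    weight [p * int_u^M k^(-p-1) dk + M^(-p)], which is exactly [u^(-p)]
    ([level_integralE]). On the right-hand side the weight is

      p * int_u^M (1 - u/k)^p dk/k + (1 - u/M)^p.

    As [1 - u/k] lies in [0, 1] and [p > 1], the [p]-th powers are at most the
    first powers, and [int_u^M (1 - u/k) dk/k = ln (M/u) - (1 - u/M)]; what is
    left over, [(1 - p) * (1 - u/M)], is nonpositive, and the bound
    [p * ln (M/u)] follows ([excess_integral_le], [integral_levels]).

    The other half of the work is the formula for the gradient of a truncation.
    A weak gradient is one chosen among all the candidates, so that the formula
    needs both that [- 1_{u <= k} Du] is a weak gradient of [(u - k)_-]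
    ([is_weak_gradient_funrneg]) and that weak gradients are almost everywhere
    unique ([weak_gradient_ae_unique]). Uniqueness is the fundamental lemma of
    the calculus of variations ([du_bois_reymond]): a function orthogonal to all
    the test functions has zero integral over every small box, because
    indicators of boxes are limits of smooth bumps, hence vanishes almost
    everywhere.

    The chain rule is obtained from difference quotients and convexity, with no
    regularization of [u]. Let [w] be a convex function of [u] (here
    [w = (u - k)_-]), [a] a bounded selection of its subgradient, [g] a weak
    partial derivative of [u] in the direction [e], and [c] one of the signs
    [1] and [-1]. The defect

      D_h(x) = (w(x + h c e) - w(x)) - a(x) (u(x + h c e) - u(x))

    is nonnegative. By duality and [du_bois_reymond], [u(x + h c e) - u(x)] is
    almost everywhere the integral of [c g] along the segment from [x] to
    [x + h c e]. Hence, for a test function [phi], the integral of [D_h phi] is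
    [- c] times the sum of the integrals of [w] and [g] against the integrals of
    [d_e phi] and of [a phi] along segments of length [h] ([line_integral_dual]).
    The factors averaged here are bounded, so Lebesgue's differentiation
    theorem on lines and dominated convergence apply ([cvg_line_average]), and
    dividing by [h] gives the limit [- c L(phi)], where
    [L(phi) = int w d_e phi + int g a phi]. For [phi >= 0] both signs of [c] give
    a nonnegative limit, so [L(phi) = 0]; moreover the defects, divided by [h],
    then tend to zero in the mean, so that [L(phi) = 0] for all the test
    functions, each of which is dominated by a nonnegative one
    ([chain_rule_local]). The subgradient may be chosen freely at the kink
    [u = k]; the choice that keeps the set [u = k] makes the top level
    [M] account for all of [|Du|^p], including the part where [u = M]. *)

(** * Boxes, Borel sets and translations *)

Section boxes.
Context {R : realType} {N : nat}.
Local Notation V := 'rV[R]_N.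
Implicit Types (a b x y : V) (r : R).

Definition box a b : set V := [set x | forall i, x 0 i \in `]a 0 i, b 0 i[].

Definition cbox a b : set V := [set x | forall i, x 0 i \in `[a 0 i, b 0 i]].

Lemma box_sub_cbox a b : box a b `<=` cbox a b.
Proof. by move=> x abx i; apply: subset_itv_oo_cc; exact: abx. Qed.

Lemma open_box a b : open (box a b).
Proof.
rewrite openE => x abx; rewrite /interior.
suff h i : \forall z \near x, (z : V) 0 i \in `]a 0 i, b 0 i[ by exact: filter_forall h.
have /= := abx i; rewrite in_itv/= => /andP[ax xb].
have cx : {for x, continuous (fun z : V => z 0 i)} by exact: coord_continuous.
near=> z; rewrite in_itv/=; apply/andP; split; near: z.
- exact: (cvgr_gt _ cx).
- exact: (cvgr_lt _ cx).
Unshelve. all: by end_near. Qed.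

Lemma measurable_box a b : measurable (box a b).
Proof. apply: open_measurable_rV; exact: open_box. Qed.

Lemma compact_cbox a b : compact (cbox a b).
Proof.
apply: (@rV_compact R N (fun i => [set` `[a 0 i, b 0 i]])) => i.
exact: segment_compact.
Qed.

Lemma setI_box a b c d : box a b `&` box c d =
  box (\row_i Num.max (a 0 i) (c 0 i)) (\row_i Num.min (b 0 i) (d 0 i)).
Proof.
apply/seteqP; split=> x /=.
  move=> [abx cdx] i; have := abx i; have := cdx i; rewrite /= !mxE !in_itv/=.
  by rewrite gt_max lt_min => /andP[-> ->] /andP[-> ->].
move=> h; split=> i; have := h i; rewrite /= !mxE !in_itv/= gt_max lt_min;
  by case/andP => /andP[ax cx] /andP[xb xd]; rewrite ?ax ?cx.
Qed.

Lemma cubeE y r : cube y r = box (y - const_mx r) (y + const_mx r).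
Proof.
by apply/seteqP; split=> x /= h i; have := h i; rewrite ltr_distl /= !mxE in_itv.
Qed.

Lemma cube_center y r : 0 < r -> cube y r y.
Proof. by move=> r0 i; rewrite subrr normr0. Qed.

Lemma open_cube y r : open (cube y r).
Proof. rewrite cubeE; exact: open_box. Qed.

Lemma cube_ball y r : 0 < r -> cube y r = ball y r.
Proof.
move=> r0; apply/seteqP; split=> x.
  by move=> yx; split=> // i j; rewrite (ord1 i) /ball/= distrC.
by move=> [_ yx] i; have := yx 0 i; rewrite /ball/= distrC.
Qed.

Definition rat_cube (z : 'rV[rat]_N * rat) : set V :=
  cube (\row_i ratr (z.1 0 i)) (ratr z.2).

(** The rational cubes form a countable base, which reduces measurability and
    negligibility questions on open sets to single cubes. The predicate [P]
    restricts the cover to cubes with a property shared by all the sets that are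
    small enough. *)
Lemma open_bigcup_rat_cube (U : set V) (P : set V -> Prop) : open U ->
  (forall x, U x -> exists2 r : R, 0 < r & forall A, A `<=` cube x r -> P A) ->
  U = \bigcup_(z in [set z | P (rat_cube z) /\ rat_cube z `<=` U]) rat_cube z.
Proof.
move=> oU HP.
apply/seteqP; split => [x Ux|x [z /= [_ zU] zx]]; last exact: zU.
have [e1 /= e10 xeU] := open_subball oU Ux.
have [e2 e20 Pe2] := HP _ Ux.
have [e e0 [ee1 ee2]] : exists2 e : R, 0 < e & e < e1 /\ e <= e2.
  exists (Num.min (e1 / 2) e2); first by rewrite lt_min e20 divr_gt0.
  split; last by rewrite ge_min lexx orbT.
  by rewrite gt_min ltr_pdivrMr// mulr2n mulrDr mulr1 ltrDl e10.
(* The radius of the rational cube is below 2d and its center within d of x, so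
   that a point of it is within 3d < e of x *)
pose d : R := e / 4%:R.
have d0 : 0 < d by rewrite divr_gt0.
have d2 : d < d *+ 2 by rewrite mulr2n ltrDl.
have [q] := rat_in_itvoo d2; rewrite in_itv/= => /andP[dq qd].
have /choice[c cP] : forall i, exists c : rat, `|x 0 i - ratr c| < d.
  move=> i; have xd : x 0 i - d < x 0 i + d by rewrite ltrD2l gtrN.
  have [c] := rat_in_itvoo xd.
  by rewrite in_itv/= => xc; exists c; rewrite distrC ltr_distl.
have sub : rat_cube (\row_i c i, q) `<=` cube x e.
  move=> w Bw i; have := Bw i; rewrite /= !mxE => wi.
  have := cP i; rewrite distrC => ci.
  rewrite -(subrKA (ratr (c i))) (le_lt_trans (ler_normD _ _))//.
  by rewrite (lt_trans (ltrD (lt_trans wi qd) ci))// /d; lra.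
exists (\row_i c i, q) => /=; last first.
  by move=> i; rewrite /= !mxE (lt_trans (cP i)).
split.
- apply: Pe2; apply: subset_trans sub _ => w /= + i => /(_ i) xw.
  exact: lt_le_trans ee2.
- apply: subset_trans sub _ => w xw; apply: (xeU e) => //=.
  by rewrite sub0r normrN gtr0_norm.
  by rewrite -cube_ball.
Qed.

Definition boxes : set (set V) := [set A | exists a b, A = box a b].

Lemma measurable_boxesE : @measurable _ V = <<s boxes >>.
Proof.
apply/seteqP; split; last first.
  apply: smallest_sub; first exact: sigma_algebra_measurable.
  by move=> _ [a [b ->]]; exact: measurable_box.
apply: smallest_sub; first exact: smallest_sigma_algebra.
move=> U oU.
rewrite (@open_bigcup_rat_cube U (fun=> True) oU); last first.
  by move=> x _; exists 1.
rewrite bigcup_mkcond.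
apply: (@countable_bigcupT_measurable _ (g_sigma_algebraType boxes)) => // z.
case: ifP => _ //; apply: sub_sigma_algebra; rewrite /rat_cube cubeE.
by do 2 eexists.
Qed.

Lemma setI_closed_boxes : setI_closed boxes.
Proof.
by move=> _ _ [a [b ->]] [c [d ->]]; rewrite setI_box; do 2 eexists.
Qed.

Lemma coord_le_norm x i : `|x 0 i| <= `|x|.
Proof.
rewrite [leRHS]/Num.norm/= mx_normrE/=.
exact: (le_bigmax_cond _ (fun ij => `|x ij.1 ij.2|) (j := (0, i))).
Qed.

Lemma bigcup_cube0 : \bigcup_k cube (0 : V) k.+1%:R = setT.
Proof.
rewrite -subTset => x _; exists (Num.truncn `|x|) => // i; rewrite mxE subr0.
apply: le_lt_trans (truncnS_gt _).
exact: coord_le_norm.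
Qed.

(** Boxes form a generating family stable under intersection. *)
Lemma box_measure_unique (m1 m2 : {measure set V -> \bar R}) :
  (forall a b, m1 (box a b) = m2 (box a b)) ->
  (forall k, m1 (cube 0 k.+1%:R) < +oo)%E ->
  forall A, measurable A -> m1 A = m2 A.
Proof.
move=> m12 m1oo A mA.
apply: (measure_unique boxes (fun k => cube 0 k.+1%:R)) => //.
- exact: measurable_boxesE.
- exact: setI_closed_boxes.
- by move=> i; rewrite cubeE; do 2 eexists.
- exact: bigcup_cube0.
- by move=> _ [a [b ->]].
Qed.

Lemma measurable_rV_coord (d : measure_display) (T : measurableType d)
    (f : T -> V) :
  (forall i, measurable_fun setT (fun t => f t 0 i : measurableTypeR R)) ->
  measurable_fun setT f.
Proof.
move=> mf; have -> : f = rV_of_tuple \o (fun t => [tuple f t 0 i | i < N]).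
  by apply/funext => t; apply/rowP => i; rewrite /= mxE tnth_mktuple.
apply: measurableT_comp; first exact: measurable_rV_of_tuple.
apply/measurable_fun_tnthP => i.
by rewrite (_ : _ \o _ = fun t => f t 0 i)//; apply/funext => t /=; rewrite tnth_mktuple.
Qed.

Lemma continuous_measurable_rV (f : V -> R) :
  continuous f -> measurable_fun setT f.
Proof.
move=> cf; apply: (measurability _ (RGenOpens.measurableE R)).
move=> _ [_ [a [b ->]] <-]; rewrite setTI; apply: open_measurable_rV.
by apply: open_comp => //; exact: itv_open.
Qed.

Lemma measurable_coord_rV i : measurable_fun setT (fun x : V => x 0 i).
Proof. by apply: continuous_measurable_rV; exact: coord_continuous. Qed.

Lemma measurable_shift (v : V) : measurable_fun setT (fun x : V => x + v).
Proof.
apply: measurable_rV_coord => i; under eq_fun do rewrite mxE.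
by apply: measurable_funD => //; exact: measurable_coord_rV.
Qed.

Lemma measurable_line (v : V) :
  measurable_fun setT (fun z : V * measurableTypeR R => z.1 + z.2 *: v).
Proof.
apply: measurable_rV_coord => i; under eq_fun do rewrite !mxE.
apply: measurable_funD.
  exact: (measurableT_comp (measurable_coord_rV i) measurable_fst).
by apply: measurable_funM.
Qed.

Local Notation mu := (@lebesgue_rV R N).

Lemma lebesgue_boxE a b : mu (box a b) =
  if [forall i, a 0 i <= b 0 i] then (\prod_i (b 0 i - a 0 i))%:E else 0%E.
Proof.
case: ifPn => [/forallP ab|/forallPn/= [i]]; first exact: lebesgue_rV_box.
rewrite -ltNge => ba; rewrite (_ : box a b = set0) ?measure0//.
apply/seteqP; split=> x //= /(_ i); rewrite in_itv/= => /andP[ax xb].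
by have := lt_trans (lt_trans ax xb) ba; rewrite ltxx.
Qed.

Lemma lebesgue_box_lty a b : (mu (box a b) < +oo)%E.
Proof. by rewrite lebesgue_boxE; case: ifP => _; rewrite ltry. Qed.

Lemma lebesgue_cube_lty y r : (mu (cube y r) < +oo)%E.
Proof. rewrite cubeE; exact: lebesgue_box_lty. Qed.

Lemma closed_measurable_rV (K : set V) : closed K -> measurable K.
Proof.
move=> cK; rewrite -(setCK K); apply: measurableC.
by apply: open_measurable_rV; exact: closed_openC.
Qed.

Lemma compact_measurable_rV (K : set V) : compact K -> measurable K.
Proof.
by move=> cK; apply: closed_measurable_rV; exact: compact_closed.
Qed.

Lemma compact_lebesgue_lty (K : set V) : compact K -> (mu K < +oo)%E.
Proof.
move=> cK; have /compact_bounded [M [_ MK]] := cK.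
apply: le_lt_trans (lebesgue_cube_lty 0 (`|M| + 2)).
apply: le_measure; rewrite ?inE.
- exact: compact_measurable_rV.
- by apply: open_measurable_rV; exact: open_cube.
move=> x Kx i; rewrite mxE subr0 (le_lt_trans (coord_le_norm _ _))//.
have := MK (`|M| + 1) _ x Kx => /(_ _)/le_lt_trans; apply.
  by rewrite ltr_pwDr// ler_norm.
by rewrite ltrD2l ltr1n.
Qed.

(** Translating a box keeps the lengths of its edges, and measures are determined
    by the volumes of boxes. *)
Lemma lebesgue_rV_shift (v : V) A : measurable A ->
  mu ((fun x => x + v) @^-1` A) = mu A.
Proof.
pose m : {measure set V -> \bar R} :=
  measure_function_pushforward__canonical__measure_function_Measure
    mu (measurable_shift v).
have mbox a b : m (box a b) = mu (box a b).
  rewrite [LHS](_ : _ = mu (box (a - v) (b - v))).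
    rewrite !lebesgue_boxE; congr (if _ then _%:E else _).
      by apply: eq_forallb => i; rewrite !mxE lerD2r.
    by apply: eq_bigr => i _; rewrite !mxE opprD addrACA subrr addr0.
  congr (mu _); apply/seteqP; split=> x h i; have := h i;
    by rewrite /= !mxE !in_itv/= ltrBlDr ltrBrDr.
move=> mA; rewrite -[RHS](box_measure_unique mbox)// => k.
by rewrite cubeE mbox lebesgue_box_lty.
Qed.

End boxes.

(** * Smooth bump functions *)
Section flat.
Context {R : realType}.
Implicit Types (P : {poly R}) (c t : R).

(** The polynomial factor makes the family, with [c] fixed, stable under
    derivation; every member is therefore smooth, which is the classical argument
    for [exp (- 1 / t)]. *)
Definition flat P c t : R := if 0 < t then P.[t^-1] * expR (- (c / t)) else 0.

Lemma flat_le0 P c t : t <= 0 -> flat P c t = 0.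
Proof. by move=> t0; rewrite /flat ltNge t0. Qed.

Lemma expRN_div_le c t : 0 < c -> 0 < t -> expR (- (c / t)) <= t / c.
Proof.
move=> c0 t0; rewrite expRN invf_ple ?posrE ?expR_gt0 ?divr_gt0// invf_div.
by apply: le_trans (expR_ge1Dx _); rewrite lerDr.
Qed.

(** Induction on the degree: each additional factor [t^-1] is absorbed by half
    of the exponential, since [t^-1 * exp (- c / (2 t)) <= 2 / c]. *)
Lemma flat_bound P c : 0 < c ->
  exists2 C : R, 0 <= C & forall t, `|flat P c t| <= C * `|t|.
Proof.
elim/poly_ind: P c => [|P a IH] c c0.
  by exists 0 => // t; rewrite /flat horner0 mul0r if_same normr0 mul0r.
have [|C C0 HC] := IH (c / 2); first by rewrite divr_gt0.
have D0 : 0 <= C * (2 / c) + `|a| / c.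
  by have := ltW c0 => c0'; rewrite addr_ge0 ?mulr_ge0 ?invr_ge0.
exists (C * (2 / c) + `|a| / c) => // t.
have [t0|t0] := leP t 0; first by rewrite flat_le0// normr0 mulr_ge0.
have -> : flat (P * 'X + a%:P) c t =
    flat P (c / 2) t * (t^-1 * expR (- (c / 2 / t))) + a * expR (- (c / t)).
  rewrite /flat t0 hornerMXaddC mulrDl; congr (_ + _).
  rewrite mulrACA -expRD; congr (_ * expR _).
  by rewrite -opprD -mulrDl -splitr.
rewrite (le_trans (ler_normD _ _))// mulrDl lerD//.
  have hE : t^-1 * expR (- (c / 2 / t)) <= 2 / c.
    rewrite ler_pdivrMl//; have := @expRN_div_le (c / 2) t.
    by rewrite divr_gt0// invf_div => /(_ isT t0).
  have hE0 : 0 <= t^-1 * expR (- (c / 2 / t)).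
    by rewrite mulr_ge0 ?expR_ge0// invr_ge0 ltW.
  by rewrite normrM [leRHS]mulrAC ler_pM// ger0_norm.
rewrite normrM -[leRHS]mulrA ler_wpM2l// (ger0_norm (expR_ge0 _)) (gtr0_norm t0).
by rewrite [leRHS]mulrC; exact: expRN_div_le.
Qed.

Let flat_is_derive_pos P c t : 0 < t ->
  is_derive t 1 (fun s => P.[s^-1] * expR (- (c / s)))
    (flat ('X^2 * (c *: P - P^`())) c t).
Proof.
move=> t0.
have t0' : t != 0 by rewrite gt_eqF.
have dV : is_derive t 1 (fun s : R => s^-1) (- t ^- 2).
  by apply: is_derive_eq (is_deriveV _ _) _ => //=; rewrite /GRing.scale/= mulr1.
have dP : is_derive t 1 (fun s => P.[s^-1]) (P^`().[t^-1] * - t ^- 2).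
  exact: (@is_derive1_comp _ (horner P) (fun s => s^-1) t _ _
    (is_derive_poly P _) dV).
have dE : is_derive t 1 (fun s => expR (- (c / s)))
    (expR (- (c / t)) * (c * t ^- 2)).
  have dc : is_derive t 1 (fun s : R => - (c / s)) (c * t ^- 2).
    have := is_deriveN (is_deriveZ c dV).
    by rewrite /GRing.scale/= mulrN opprK; exact.
  exact: (@is_derive1_comp _ expR (fun s => - (c / s)) t _ _
    (is_derive_expR _) dc).
apply: is_derive_eq (is_deriveM dP dE) _.
rewrite /flat t0 !hornerE /GRing.scale/= exprVn; ring.
Qed.

(** Away from [0] this is the product rule. At [0] the difference quotient is
    the member of the family for [P * 'X], which tends to zero by
    [flat_bound]. *)
Lemma is_derive_flat P c t : 0 < c ->
  is_derive t 1 (flat P c) (flat ('X^2 * (c *: P - P^`())) c t).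
Proof.
have ct : (fun s : R => s) @ t --> t by exact: cvg_id.
move=> c0; have [t0|t0|->] := ltgtP t 0.
- rewrite (flat_le0 _ _ (ltW t0)).
  apply: near_eq_is_derive (is_derive_cst 0 t 1).
  near=> s; rewrite flat_le0//; near: s.
  exact: (cvgr_le _ ct).
- apply: near_eq_is_derive (flat_is_derive_pos P c t0).
  near=> s; rewrite /flat ifT//; near: s.
  exact: (cvgr_gt _ ct).
- rewrite [X in is_derive _ _ _ X]flat_le0//.
  suff H : (fun h => h^-1 *: ((flat P c \o shift 0) (h *: 1) - flat P c 0)) @ 0^'
      --> (0 : R).
    by apply: DeriveDef; [apply/cvg_ex; exists 0|exact/cvg_lim].
  have [C C0 HC] := flat_bound (P * 'X) c0.
  apply/norm_cvg0P; apply: (@squeeze_cvgr _ _ _ _ (fun=> 0) (fun h => C * `|h|)).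
  + near=> h; rewrite normr_ge0/= addr0 (flat_le0 _ _ (lexx 0)) subr0.
    rewrite /GRing.scale/= mulr1; apply: le_trans (HC h).
    rewrite /flat; case: ifPn => h0; last by rewrite mulr0.
    by rewrite hornerMX mulrAC mulrC.
  + exact: cvg_cst.
  + have H0 : (fun h : R => C * `|h|) @ (0 : R) --> C * `|0 : R|.
      by apply: cvgM; [exact: cvg_cst|apply: cvg_norm; exact: cvg_id].
    rewrite normr0 mulr0 in H0.
    by apply: cvg_trans H0; apply: cvg_app; exact: cvg_within.
Unshelve. all: by end_near. Qed.

End flat.

Section elementary.
Context {R : realType} {N : nat}.
Local Notation V := 'rV[R]_N.
Implicit Types (f g : V -> R) (x v : V).

(** A directional derivative is an ordinary derivative along a line, which gives
    access to the one-variable rules for composition. *)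
Lemma is_derive_line f x v (t d : R) :
  is_derive (x + t *: v) v f d <->
  is_derive t 1 (fun s : R => f (x + s *: v)) d.
Proof.
pose G (s : R) := f (x + s *: v).
have E : (fun h : R => h^-1 *: ((f \o shift (x + t *: v)) (h *: v)
      - f (x + t *: v))) =
    (fun h : R => h^-1 *: ((G \o shift t) (h *: (1 : R)) - G t)).
  apply/funext => h /=; congr (_ *: (f _ - _)).
  by rewrite /GRing.scale/= mulr1 [LHS]addrC -addrA -scalerDl [t + h]addrC.
have E1 : derivable f (x + t *: v) v = derivable G t 1.
  exact: (congr1 (fun F : R -> R => cvg (F @ 0^')) E).
have E2 : 'D_v f (x + t *: v) = 'D_1 G t.
  exact: (congr1 (fun F : R -> R => lim (F @ 0^')) E).
split=> -[h1 h2]; apply: DeriveDef.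
- by rewrite -[derivable _ _ _]E1.
- by rewrite -[LHS]E2.
- by rewrite E1.
- by rewrite E2.
Qed.

Lemma is_derive_dir f x v (d : R) :
  is_derive (0 : R) 1 (fun s : R => f (x + s *: v)) d -> is_derive x v f d.
Proof. by move/is_derive_line; rewrite scale0r addr0. Qed.

(** A class stable under partial derivatives by construction, so that each of its
    elements has derivatives of all orders. *)
Inductive elementary : (V -> R) -> Prop :=
| elementary_flat P (c s a : R) i :
    0 < c -> elementary (fun x => flat P c (s * x 0 i + a))
| elementary_cst (a : R) : elementary (fun=> a)
| elementary_add f g :
    elementary f -> elementary g -> elementary (fun x => f x + g x)
| elementary_mul f g :
    elementary f -> elementary g -> elementary (fun x => f x * g x).

Lemma elementary_continuous f : elementary f -> continuous f.
Proof.
elim=> {f} [P c s a i c0|a|f g _ cf _ cg|f g _ cf _ cg] x.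
- apply: (@continuous_comp _ _ _ (fun x : V => s * x 0 i + a) (flat P c)).
    apply: (@continuousD _ _ _ (fun x1 : V => s * x1 0 i) (fun=> a)).
      apply: (@continuousM _ _ (fun=> s) (fun x1 : V => x1 0 i)).
        exact: cst_continuous.
      exact: coord_continuous.
    exact: cst_continuous.
  apply: differentiable_continuous; apply/derivable1_diffP.
  by have [] := is_derive_flat P (s * x 0 i + a) c0.
- exact: cst_continuous.
- by apply: (@continuousD _ _ _ f g); [exact: cf|exact: cg].
- by apply: (@continuousM _ _ f g); [exact: cf|exact: cg].
Qed.

Lemma elementary_derive f j : elementary f ->
  exists2 df, elementary df & forall x, is_derive x (delta_mx 0 j) f (df x).
Proof.
elim=> {f} [P c s a i c0|a|f g ef [df edf Hf] eg [dg edg Hg]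
           |f g ef [df edf Hf] eg [dg edg Hg]].
- exists (fun x => (s * (i == j)%:R) *
      flat ('X^2 * (c *: P - P^`())) c (s * x 0 i + a)).
    apply: elementary_mul; first exact: elementary_cst.
    exact: elementary_flat.
  move=> x; apply: is_derive_dir.
  have dl : is_derive (0 : R) 1 (fun t : R => s * (x + t *: delta_mx 0 j) 0 i + a)
      (s * (i == j)%:R).
    rewrite (_ : (fun t : R => _) = (fun t : R => (s * (i == j)%:R) * t +
        (s * x 0 i + a))).
      by apply: is_derive_eq; rewrite addr0 /GRing.scale/= mulr1.
    by apply/funext => t; rewrite !mxE eqxx/=; ring.
  have := is_derive_flat P (s * x 0 i + a) c0.
  have -> : s * x 0 i + a = s * (x + 0 *: delta_mx 0 j) 0 i + a.
    by rewrite scale0r addr0.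
  move=> dfl; rewrite mulrC.
  exact: (@is_derive1_comp _ (flat P c) _ (0 : R) _ _ dfl dl).
- by exists (fun=> 0) => [|x]; [exact: elementary_cst|exact: is_derive_cst].
- exists (fun x => df x + dg x); first exact: elementary_add.
  by move=> x; exact: (is_deriveD (Hf x) (Hg x)).
- exists (fun x => f x * dg x + g x * df x).
    by apply: elementary_add; apply: elementary_mul.
  by move=> x; exact: (is_deriveM (Hf x) (Hg x)).
Qed.

Lemma elementary_smooth f : elementary f -> smooth f.
Proof.
move=> ef s; have es : elementary (foldr partial f s).
  elim: s => //= i s /(elementary_derive i)[df edf Hdf].
  rewrite (_ : partial i _ = df)//; apply/funext => x.
  by have [_ <-] := Hdf x.
split; first exact: elementary_continuous.
by move=> x i; have [df edf Hdf] := elementary_derive i es; case: (Hdf x).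
Qed.

Lemma elementary_prod (I : Type) (r : seq I) (F : I -> V -> R) :
  (forall i, elementary (F i)) -> elementary (fun x => \prod_(i <- r) F i x).
Proof.
move=> eF; elim: r => [|i r IH].
  under eq_fun do rewrite big_nil; exact: elementary_cst.
under eq_fun do rewrite big_cons; exact: elementary_mul.
Qed.

Lemma elementary_sum (I : Type) (r : seq I) (F : I -> V -> R) :
  (forall i, elementary (F i)) -> elementary (fun x => \sum_(i <- r) F i x).
Proof.
move=> eF; elim: r => [|i r IH].
  under eq_fun do rewrite big_nil; exact: elementary_cst.
under eq_fun do rewrite big_cons; exact: elementary_add.
Qed.

(** Its value in the box is [exp (- c * S)], with [S] the sum of the inverse
    distances to the faces: a small [c] brings it close to [1]. *)
Definition bump (c : R) (a b x : V) : R :=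
  \prod_(i < N) (flat 1 c (1 * x 0 i + - a 0 i) * flat 1 c (-1 * x 0 i + b 0 i)).

Lemma elementary_bump c a b : 0 < c -> elementary (bump c a b).
Proof.
by move=> c0; apply: elementary_prod => i; apply: elementary_mul;
  exact: elementary_flat.
Qed.

Lemma flat1_ge0 c t : 0 <= flat (1 : {poly R}) c t.
Proof. by rewrite /flat; case: ifP => // _; rewrite hornerC mul1r expR_ge0. Qed.

Lemma flat1_gt0 c t : (0 < flat (1 : {poly R}) c t) = (0 < t).
Proof.
by rewrite /flat; case: ifP => // _; rewrite ?ltxx// hornerC mul1r expR_gt0.
Qed.

Lemma flat1_le1 c t : 0 < c -> flat (1 : {poly R}) c t <= 1.
Proof.
move=> c0; rewrite /flat; case: ifP => // t0; rewrite hornerC mul1r.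
by rewrite -expR0 ler_expR oppr_le0 divr_ge0// ltW.
Qed.

Lemma bump_ge0 c a b x : 0 <= bump c a b x.
Proof. by apply: prodr_ge0 => i _; rewrite mulr_ge0 ?flat1_ge0. Qed.

Lemma bump_le1 c a b x : 0 < c -> bump c a b x <= 1.
Proof.
move=> c0; apply: prodr_ile1 => i _.
by rewrite mulr_ge0 ?flat1_ge0//= mulr_ile1 ?flat1_ge0 ?flat1_le1.
Qed.

Lemma bump_gt0 c a b x : box a b x -> 0 < bump c a b x.
Proof.
move=> abx; apply: prodr_gt0 => i _; have := abx i.
rewrite in_itv/= => /andP[ax xb].
by rewrite mulr_gt0// flat1_gt0 ?mul1r ?mulN1r ?subr_gt0// addrC subr_gt0.
Qed.

Lemma bump_eq0 c a b x : ~ box a b x -> bump c a b x = 0.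
Proof.
move=> /existsNP[i] /negP; rewrite in_itv/= negb_and -!leNgt => abx.
rewrite /bump (bigD1 i)//=; case/orP: abx => h; last first.
  by rewrite [X in _ * X * _]flat_le0 ?mulr0 ?mul0r// mulN1r addrC subr_le0.
by rewrite flat_le0 ?mul0r// mul1r subr_le0.
Qed.

Lemma cvg_bump a b x :
  bump n.+1%:R^-1 a b x @[n --> \oo] --> (\1_(box a b) x : R).
Proof.
have [abx|abx] := pselect (box a b x); last first.
  rewrite indicE memNset//; under eq_cvg do rewrite bump_eq0//.
  exact: cvg_cst.
rewrite indicE mem_set//.
pose S := \sum_(i < N) ((x 0 i - a 0 i)^-1 + (b 0 i - x 0 i)^-1).
have bE c : bump c a b x = expR (- (c * S)).
  rewrite /bump /S mulr_sumr -sumrN expR_sum; apply: eq_bigr => i _.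
  have := abx i; rewrite in_itv/= => /andP[ax xb].
  rewrite /flat mul1r mulN1r [- x 0 i + _]addrC !subr_gt0 ax xb !hornerC !mul1r.
  by rewrite -expRD -opprD -mulrDr.
have -> : (fun n => bump n.+1%:R^-1 a b x) =
    (fun n => expR (- (harmonic n * S))) by apply/funext => n; rewrite bE.
have H : (fun n => expR (- (harmonic n * S))) @ \oo --> expR (- (0 * S)).
  apply: (@cvg_comp _ _ _ (fun n => - (harmonic n * S)) expR _ (nbhs (- (0 * S)))).
    by apply: cvgN; apply: cvgM; [exact: cvg_harmonic|exact: cvg_cst].
  exact: continuous_expR.
by move: H; rewrite mul0r oppr0 expR0.
Qed.

Lemma test_function_bump (E : set V) c a b : 0 < c -> cbox a b `<=` E ->
  test_function E (bump c a b).
Proof.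
move=> c0 abE.
have sub : closure [set x | bump c a b x != 0] `<=` cbox a b.
  have : closed (cbox a b) by apply: compact_closed => //; exact: compact_cbox.
  move=> /closure_id ->; apply: closure_subset => x /= /eqP.
  by move=> bx0; apply: box_sub_cbox; apply: contrapT => /(bump_eq0 c).
split; first by apply: elementary_smooth; exact: elementary_bump.
- apply: (subclosed_compact _ (@compact_cbox _ _ a b)) => //.
  exact: closed_closure.
- exact: subset_trans abE.
Qed.

End elementary.

(** * The fundamental lemma of the calculus of variations *)
Section density.
Context (d : measure_display) (T : measurableType d) (R : realType).
Context (mu : {measure set T -> \bar R}) (f : T -> \bar R).
Context (mf : measurable_fun setT f) (f0 : forall x, (0 <= f x)%E).

Definition density (A : set T) : \bar R := (\int[mu]_(x in A) f x)%E.

Let density0 : density set0 = 0%E. Proof. exact: integral_set0. Qed.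

Let density_ge0 A : (0 <= density A)%E.
Proof. by apply: integral_ge0 => x _. Qed.

HB.instance Definition _ := isMeasure.Build _ _ _ density
  density0 density_ge0 (semi_sigma_additive_nng_induced mf f0).

Definition density_measure : {measure set T -> \bar R} := density.

End density.

Section du_bois_reymond.
Context {R : realType} {N : nat}.
Local Notation V := 'rV[R]_N.
Local Notation mu := (@lebesgue_rV R N).
Implicit Types (E K : set V) (f : V -> R) (a b : V).

Lemma Lploc1_integrable E f K : open E -> Lploc 1 E f -> compact K ->
  K `<=` E -> mu.-integrable K (EFin \o f).
Proof.
move=> oE [mf iF] cK KE; apply/integrableP; split.
  apply/measurable_EFinP; apply: measurable_funS mf => //.
  exact: open_measurable_rV.
apply: le_lt_trans (iF K cK KE).
by under [leRHS]eq_integral do rewrite powRr1//.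
Qed.

(** Dominated convergence, with test functions increasing to the indicator of
    the box. *)
Lemma integral_box_eq0 E f a b : open E -> Lploc 1 E f ->
  (forall phi, test_function E phi -> \int[mu]_(x in E) (f x * phi x) = 0) ->
  cbox a b `<=` E -> (\int[mu]_(x in box a b) (f x)%:E = 0)%E.
Proof.
move=> oE fL f0 abE.
have iC : mu.-integrable (cbox a b) (EFin \o f).
  exact: Lploc1_integrable oE fL (@compact_cbox _ _ a b) abE.
have mC : measurable (cbox a b) by apply: compact_measurable_rV; exact: compact_cbox.
have mf : measurable_fun (cbox a b) (EFin \o f) by exact: measurable_int iC.
pose F (n : nat) x : \bar R := (f x * bump n.+1%:R^-1 a b x)%:E.
pose G x : \bar R := (f x * \1_(box a b) x)%:E.
have mbump n : measurable_fun setT (bump n.+1%:R^-1 a b).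
  by apply: continuous_measurable_rV; apply: elementary_continuous;
    exact: elementary_bump.
have F0 n : (\int[mu]_(x in cbox a b) F n x = 0)%E.
  have tb : test_function E (bump n.+1%:R^-1 a b) by exact: test_function_bump.
  have iF : mu.-integrable (cbox a b) (F n).
    apply: le_integrable iC => //.
      apply/measurable_EFinP; apply: measurable_funM.
        exact/measurable_EFinP.
      exact: measurable_funTS.
    move=> x _; rewrite lee_fin normrM ler_piMr// ger0_norm ?bump_ge0//.
    exact: bump_le1.
  have := f0 _ tb; rewrite /Rintegral => H.
  have e : (\int[mu]_(x in E) (f x * bump n.+1%:R^-1 a b x)%:E =
     \int[mu]_(x in cbox a b) F n x)%E.
    rewrite integral_mkcond [RHS]integral_mkcond; congr (integral _ _ _).
    apply/funext => x; rewrite /patch /F.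
    have [abx|abx] := pselect (box a b x).
      by rewrite !mem_set//; [exact: box_sub_cbox|exact/abE/box_sub_cbox].
    by rewrite bump_eq0// mulr0 !if_same.
  by rewrite -[LHS]fineK ?integrable_fin_num// -e H.
have [|||||_ _ cv] :=
  @dominated_convergence _ _ _ mu _ mC F G (abse \o (EFin \o f)).
- move=> n; apply/measurable_EFinP; apply: measurable_funM.
    exact/measurable_EFinP.
  exact: measurable_funTS.
- apply/measurable_EFinP; apply: measurable_funM; first exact/measurable_EFinP.
  by apply: measurable_indic; exact: measurable_box.
- apply: aeW => x _; apply: cvg_EFin; first by near=> n.
  by apply: cvgM; [exact: cvg_cst|exact: cvg_bump].
- exact: integrable_abse.
- apply: aeW => x n _; rewrite lee_fin normrM ler_piMr// ger0_norm ?bump_ge0//.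
  exact: bump_le1.
rewrite -(setIidr (@box_sub_cbox _ _ a b)) integral_mkcondr.
transitivity (\int[mu]_(x in cbox a b) G x)%E.
  apply: eq_integral => x _; rewrite /G patchE indicE.
  by case: ifP => _; rewrite ?mulr1// mulr0.
have cv0 : [sequence (\int[mu]_(x in cbox a b) F n x)%E]_n = cst 0%E.
  by apply/funext => n; exact: F0.
by rewrite cv0 in cv; rewrite -(cvg_lim _ cv)// lim_cst.
Unshelve. all: by end_near. Qed.

(** The measures whose densities are the positive and negative parts of [f] agree
    on boxes, hence on all the Borel sets. *)
Lemma ae_eq0_box f a b : mu.-integrable (box a b) (EFin \o f) ->
  (forall c d, cbox c d `<=` cbox a b -> (\int[mu]_(x in box c d) (f x)%:E = 0)%E) ->
  {ae mu, forall x, box a b x -> f x = 0}.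
Proof.
move=> fi f0.
have mB : measurable (box a b) by exact: measurable_box.
pose g : V -> \bar R := (EFin \o f) \_ (box a b).
have gi : mu.-integrable setT g by apply/(integrable_mkcond _ mB).
have mg := measurable_int _ gi.
pose m1 := density_measure mu (measurable_funepos mg) (funepos_ge0 g).
pose m2 := density_measure mu (measurable_funeneg mg) (funeneg_ge0 g).
have gE A : (\int[mu]_(x in A) g x = \int[mu]_(x in A `&` box a b) (f x)%:E)%E.
  by rewrite integral_mkcondr.
have m1fin A : measurable A -> (m1 A < +oo)%E.
  move=> mA; apply: le_lt_trans (integral_funepos_lt_pinfty measurableT gi).
  by apply: ge0_subset_integral => //; exact: measurable_funepos.
have m2fin A : measurable A -> (m2 A < +oo)%E.
  move=> mA; apply: le_lt_trans (integral_funeneg_lt_pinfty measurableT gi).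
  by apply: ge0_subset_integral => //; exact: measurable_funeneg.
have m12 A : measurable A -> m1 A = m2 A.
  move=> mA; apply: box_measure_unique => // [c d|k]; last first.
    by apply: m1fin; rewrite cubeE; exact: measurable_box.
  have : (\int[mu]_(x in box c d) g x = 0)%E.
    rewrite gE setI_box f0// => x h i; have := h i.
    by rewrite /= !mxE !in_itv/= ge_max le_min => /andP[/andP[_ ->] /andP[_ ->]].
  rewrite integralE => /eqP; rewrite sube_eq ?add0e; first by move/eqP.
  - by rewrite ge0_fin_numE ?integral_ge0// m1fin//; exact: measurable_box.
  - by rewrite fin_num_adde_defr.
have : ae_eq mu (box a b) (EFin \o f) (cst 0%E).
  apply: integral_ae_eq => // A AB mA.
  rewrite integral0 -(setIidl AB) -gE integralE.
  rewrite -[X in (X - _)%E]/(m1 A) -[X in (_ - X)%E]/(m2 A) m12// subee//.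
  by rewrite ge0_fin_numE ?integral_ge0// m2fin.
by apply: filterS => x /= h /h [].
Qed.

(** The previous lemma applies in boxes whose closure lies in [E], and countably
    many rational cubes contained in such boxes cover [E]. *)
Theorem du_bois_reymond E f : open E -> Lploc 1 E f ->
  (forall phi, test_function E phi -> \int[mu]_(x in E) (f x * phi x) = 0) ->
  {ae mu, forall x, E x -> f x = 0}.
Proof.
move=> oE fL f0.
pose P (A : set V) := exists a b, A `<=` box a b /\ cbox a b `<=` E.
rewrite (@open_bigcup_rat_cube _ _ E P oE); last first.
  move=> x /(open_subball oE)[e /= e0 xeE].
  have e20 : 0 < e / 2 by rewrite divr_gt0.
  exists (e / 3) => [|A Axe]; first by rewrite divr_gt0.
  exists (x - const_mx (e / 3)), (x + const_mx (e / 3)).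
  split; first by rewrite -cubeE.
  move=> z xz; apply: (xeE (e / 2)) => //=.
    by rewrite sub0r normrN gtr0_norm// ltr_pdivrMr// ltr_pMr// ltr1n.
  rewrite -cube_ball// => i; have := xz i; rewrite /= !mxE in_itv/= -ler_distl.
  by move=> h; apply: le_lt_trans h _; lra.
pose bad (z : 'rV[rat]_N * rat) : set V :=
  rat_cube z `&` [set x | P (rat_cube z) /\ rat_cube z `<=` E /\ f x <> 0].
have bad0 z : mu.-negligible (bad z).
  have [[a [b [zab abE]]]|nP] := pselect (P (rat_cube z)); last first.
    by apply: (@negligibleS _ _ _ _ set0); [move=> x [_ []]|exact: negligible_set0].
  have fi : mu.-integrable (box a b) (EFin \o f).
    apply: integrableS (Lploc1_integrable oE fL (@compact_cbox _ _ a b) abE) => //.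
    - by apply: compact_measurable_rV; exact: compact_cbox.
    - exact: measurable_box.
    - exact: box_sub_cbox.
  have [c d cdab|B [mB B0 fB]] := @ae_eq0_box f a b fi.
    by apply: integral_box_eq0 oE fL f0 _; exact: subset_trans abE.
  exists B; split=> // x [zx [_ [_ fx0]]]; apply: fB => /= /(_ (zab _ zx)).
  exact: fx0.
have := @negligible_bigcup _ _ _ mu
  (fun n => if unpickle n is Some z then bad z else set0).
case=> [k|B [mB B0 badB]]; first by case: unpickle => [z|]; [exact: bad0|exact: negligible_set0].
exists B; split=> // x /= /not_implyP[[z [Pz zE] zx] fx0]; apply: badB.
by exists (pickle z) => //; rewrite pickleK.
Qed.

Lemma Lploc1P E f : open E -> Lploc 1 E f <->
  measurable_fun E f /\
  forall K, compact K -> K `<=` E -> mu.-integrable K (EFin \o f).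
Proof.
move=> oE; split=> [fL|[mf fi]].
  by split=> [|K cK KE]; [case: fL|exact: Lploc1_integrable oE fL cK KE].
split=> // K cK KE; have /integrableP[_] := fi _ cK KE.
by apply: le_lt_trans; under eq_integral do rewrite powRr1//.
Qed.

Lemma compact_bounded_fun (psi : V -> R) K : compact K -> continuous psi ->
  exists2 C, 0 <= C & forall x, K x -> `|psi x| <= C.
Proof.
move=> cK cpsi.
have /continuous_compact/(_ cK)/compact_bounded[M [_ HM]] :
  {within K, continuous psi} by exact: continuous_subspaceT.
exists (`|M| + 1) => [|x Kx]; first by rewrite addr_ge0.
by apply: HM; [rewrite ltr_pwDr// ler_norm|exists x].
Qed.

Lemma integrable_mul_compact_support E f (psi : V -> R) K : open E ->
  Lploc 1 E f -> continuous psi -> compact K -> K `<=` E ->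
  (forall x, ~ K x -> psi x = 0) ->
  mu.-integrable E (fun x => (f x * psi x)%:E).
Proof.
move=> oE fL cpsi cK KE psi0.
have mK := compact_measurable_rV cK; have mE := open_measurable_rV oE.
have fK := Lploc1_integrable oE fL cK KE.
apply/(integrable_mkcond _ mE).
rewrite (_ : _ \_ E = (fun x => (f x * psi x)%:E) \_ K); last first.
  apply/funext => x; rewrite /patch.
  have [Kx|Kx] := pselect (K x); first by rewrite !mem_set//; exact: KE.
  by rewrite psi0// mulr0 !if_same.
apply/(integrable_mkcond _ mK).
have [C C0 HC] := compact_bounded_fun cK cpsi.
have mpsi : measurable_fun K psi by apply: measurable_funTS; exact: continuous_measurable_rV.
have mf : measurable_fun K f by apply/measurable_EFinP; exact: measurable_int fK.
apply: (@le_integrable _ _ _ mu K mK _ (fun x => (C%:E * (f x)%:E)%E)).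
- by apply/measurable_EFinP; exact: measurable_funM.
- move=> x Kx; rewrite -EFinM lee_fin mulrC !normrM ler_wpM2r//.
  by rewrite (ger0_norm C0) HC.
- exact: integrableZl.
Qed.

Lemma test_function_derive E phi : test_function E phi ->
  [/\ continuous phi, forall x i, derivable phi x (delta_mx 0 i),
    forall i, continuous (partial i phi) &
    forall x, ~ closure [set x | phi x != 0] x ->
      phi x = 0 /\ forall i, partial i phi x = 0].
Proof.
move=> [sphi cK KE]; split.
- by have [] := sphi [::].
- by move=> x i; have [_] := sphi [::]; apply.
- by move=> i; have [] := sphi [:: i].
- move=> x Kx.
  have phi0 : \forall z \near x, phi z = 0.
    have : nbhs x (~` closure [set x | phi x != 0]).
      by apply: open_nbhs_nbhs; split=> //; apply: closed_openC; exact: closed_closure.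
    apply: filterS => z Kz; apply: contrapT => /eqP phiz; apply: Kz.
    exact: subset_closure.
  split; first exact: nbhs_singleton phi0.
  move=> i; rewrite /partial (near_eq_derive _ (g := cst 0))//.
  exact: derive_cst.
Qed.

Lemma weak_gradient_ae_unique E f g1 g2 : open E ->
  is_weak_gradient E f g1 -> is_weak_gradient E f g2 ->
  {ae mu, forall x, E x -> g1 x = g2 x}.
Proof.
move=> oE [_ g1L Hg1] [_ g2L Hg2].
have H i : {ae mu, forall x, E x -> g1 x 0 i - g2 x 0 i = 0}.
  apply: du_bois_reymond => //.
    have [m1 i1] := (Lploc1P _ oE).1 (g1L i).
    have [m2 i2] := (Lploc1P _ oE).1 (g2L i).
    apply/(Lploc1P _ oE); split; first exact: measurable_funB.
    move=> K cK KE; have mK := compact_measurable_rV cK.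
    by have := integrableB mK (i1 K cK KE) (i2 K cK KE).
  move=> phi tphi.
  have [cphi _ _ phi0] := test_function_derive tphi; have [_ cK KE] := tphi.
  have phi0' x (Kx : ~ _) := (phi0 x Kx).1.
  under eq_Rintegral do rewrite mulrBl.
  rewrite RintegralB//.
  - have := Hg1 _ tphi i; rewrite (Hg2 _ tphi i) => /oppr_inj ->.
    by rewrite subrr.
  - exact: open_measurable_rV.
  - exact: integrable_mul_compact_support (g1L i) cphi cK KE phi0'.
  - exact: integrable_mul_compact_support (g2L i) cphi cK KE phi0'.
have : {ae mu, forall x, forall i, E x -> g1 x 0 i - g2 x 0 i = 0}.
  exact: filter_forall H.
apply: filterS => x Hx Ex; apply/rowP => i; apply/eqP; rewrite -subr_eq0.
by rewrite Hx.
Qed.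

End du_bois_reymond.

(** * Averages along lines *)
Section measure_preserving.
Context (d : measure_display) (T : measurableType d) (R : realType).
Context (m : {measure set T -> \bar R}) (phi : T -> T).
Context (mphi : measurable_fun setT phi).
Context (phiE : forall A, measurable A -> m (phi @^-1` A) = m A).

Lemma ge0_integral_preserving (f : T -> \bar R) : measurable_fun setT f ->
  (forall x, (0 <= f x)%E) -> (\int[m]_x f (phi x) = \int[m]_x f x)%E.
Proof.
move=> mf f0.
have := ge0_integral_pushforward mphi m measurableT mf (fun x _ => f0 x).
rewrite preimage_setT => <-.
by apply: eq_measure_integral => A mA _; rewrite -phiE.
Qed.

Lemma integrable_preserving (f : T -> \bar R) :
  m.-integrable setT f -> m.-integrable setT (f \o phi).
Proof.
move=> /integrableP[mf foo]; apply/integrableP; split; first exact: measurableT_comp.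
rewrite (ge0_integral_preserving (f := abse \o f))// => [|x] /=.
  exact: measurableT_comp.
exact: abse_ge0.
Qed.

Lemma integral_preserving (f : T -> \bar R) : measurable_fun setT f ->
  (\int[m]_x f (phi x) = \int[m]_x f x)%E.
Proof.
move=> mf; rewrite integralE [RHS]integralE; congr (_ - _)%E.
- have := ge0_integral_preserving (measurable_funepos mf) (funepos_ge0 f) => <-.
  by apply: eq_integral => x _; rewrite !funeposE.
- have := ge0_integral_preserving (measurable_funeneg mf) (funeneg_ge0 f) => <-.
  by apply: eq_integral => x _; rewrite !funenegE.
Qed.

End measure_preserving.

Section Rfubini.
Context (d1 d2 : measure_display) (T1 : measurableType d1) (T2 : measurableType d2).
Context (R : realType) (m1 : {sigma_finite_measure set T1 -> \bar R}).
Context (m2 : {sigma_finite_measure set T2 -> \bar R}) (f : T1 * T2 -> R).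
Context (fi : (m1 \x m2)%E.-integrable setT (EFin \o f)).

Let ae_fine d (T : measurableType d) (m : {measure set T -> \bar R})
    (g : T -> \bar R) : m.-integrable setT g ->
  m.-integrable setT (fun x => (fine (g x))%:E) /\
  (\int[m]_x (fine (g x))%:E = \int[m]_x g x)%E.
Proof.
move=> gi; have mg := measurable_int _ gi.
have mfg : measurable_fun setT (fun x => (fine (g x))%:E).
  by apply/measurable_EFinP; exact: measurableT_comp.
split.
  apply: le_integrable gi => // x _; rewrite /=.
  by case: (g x) => [r||] //=; rewrite normr0 ?leey.
apply: ae_eq_integral => //; apply: filterS (integrable_ae measurableT gi).
by move=> x gx _; rewrite fineK// gx.
Qed.

Lemma integrable_Rfubini1 :
  m1.-integrable setT (fun x => (\int[m2]_y f (x, y))%:E).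
Proof. exact: (ae_fine (integrable_fubini_F fi)).1. Qed.

Let integrable_G : m2.-integrable setT (fubini_G m1 (EFin \o f)).
Proof.
have mf := measurable_int _ fi.
apply/integrableP; split; first exact: (measurable_fubini_G fi).
have foo := (integrable21ltyP m1 m2 mf).1 fi.
apply: le_lt_trans foo; apply: ge0_le_integral => //.
- by apply: measurableT_comp => //; exact: (measurable_fubini_G fi).
- apply: (@measurable_fun_fubini_tonelli_G _ _ _ _ _ m1 (abse \o (EFin \o f))) => //.
    exact: measurableT_comp.
  by move=> z; exact: abse_ge0.
- move=> y _; apply: le_abse_integral => //.
  exact: (measurableT_comp mf (pair2_measurable y)).
Qed.

Lemma Rfubini : \int[m1]_x \int[m2]_y f (x, y) = \int[m2]_y \int[m1]_x f (x, y).
Proof.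
congr fine.
have h1 := (ae_fine (integrable_fubini_F fi)).2.
have h2 := (ae_fine integrable_G).2.
by rewrite [LHS]h1 [RHS]h2; exact: (Fubini fi).
Qed.

End Rfubini.

Section line_average.
Context {R : realType} {N : nat}.
Local Notation V := 'rV[R]_N.
Local Notation mu := (@lebesgue_rV R N).
Local Notation lam := (@lebesgue_measure R).
Implicit Types (f psi : V -> R) (v w x : V) (h C : R).

Lemma lebesgue_shift (t : R) (A : set (measurableTypeR R)) : measurable A ->
  lam ((fun s => s + t) @^-1` A) = lam A.
Proof.
have mt : measurable_fun [set: measurableTypeR R] (fun s => s + t : measurableTypeR R).
  exact: measurable_funD.
pose m : {measure set (measurableTypeR R) -> \bar R} :=
  measure_function_pushforward__canonical__measure_function_Measure lam mt.
move=> mA; rewrite [RHS](@lebesgue_measure_unique _ m)// => _ [[a b] _ <-] /=.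
rewrite /pushforward/= (_ : _ @^-1` _ = `]a - t, b - t]%classic).
  rewrite !lebesgue_measure_itv/= !lte_fin ltrD2r; case: ifP => // _.
  by rewrite -!EFinB; congr (_%:E); ring.
by apply/seteqP; split=> s /=; rewrite !in_itv/= ltrBlDr lerBrDr.
Qed.

Definition line_integral v h f x : R := \int[lam]_(s in `[0, h]) f (x + s *: v).

Lemma line_integralE v h f x :
  line_integral v h f x = \int[lam]_s (\1_`[0, h] s * f (x + s *: v)).
Proof.
rewrite /line_integral Rintegral_mkcond; apply: eq_Rintegral => s _.
by rewrite patchE indicE; case: ifP => _; rewrite ?mul1r ?mul0r.
Qed.

Lemma measurable_sweep v f : measurable_fun setT f ->
  measurable_fun setT (fun z : V * measurableTypeR R => f (z.1 + z.2 *: v)).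
Proof. by move=> mf; exact: (measurableT_comp mf (measurable_line v)). Qed.

Lemma measurable_sweep_indic h : measurable_fun setT
  (fun z : V * measurableTypeR R => \1_`[0, h] z.2 : R).
Proof.
by apply: (@measurableT_comp _ _ _ _ _ _ (\1_`[0, h] : measurableTypeR R -> R)).
Qed.

Lemma lebesgue_itv0_lty h : (lam `[0%R, h]%classic < +oo)%E.
Proof.
rewrite [ltLHS]lebesgue_measure_itv/=; by case: ifP => _; rewrite ?ltry.
Qed.

Lemma lebesgue_itv0 h : 0 <= h -> lam `[0, h]%classic = h%:E.
Proof.
move=> h0; rewrite [LHS]lebesgue_measure_itv/= lte_fin.
case: ltP => h0'; first by rewrite -EFinB subr0.
by congr (_%:E); apply/eqP; rewrite eq_le h0 h0'.
Qed.

Lemma integrable_itv0_cst h C : lam.-integrable `[0, h] (fun=> C%:E).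
Proof.
apply: measurable_bounded_integrable => //.
  exact: lebesgue_itv0_lty.
exists `|C|; split; first exact: num_real.
by move=> M CM s _; exact: ltW.
Qed.

Lemma Rintegral_itv0_cst h C : 0 <= h -> \int[lam]_(s in `[0, h]) C = C * h.
Proof. by move=> h0; rewrite Rintegral_cst//=; congr (_ * _); rewrite [X in fine X]lebesgue_itv0. Qed.

Lemma integral_indic_itv h : 0 <= h ->
  (\int[lam]_s (\1_`[0, h] s)%:E = h%:E)%E.
Proof.
by move=> h0; rewrite integral_indic// setIT; exact: lebesgue_itv0.
Qed.

(** The volume swept by moving [f] along a segment: each slice has the same
    integral by invariance under translation. *)
Lemma integrable_sweep v h f : 0 <= h -> mu.-integrable setT (EFin \o f) ->
  (mu \x lam)%E.-integrable setT
    (EFin \o (fun z => \1_`[0, h] z.2 * f (z.1 + z.2 *: v))).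
Proof.
move=> h0 fi; have mf : measurable_fun setT f.
  by apply/measurable_EFinP; exact: measurable_int fi.
have mF : measurable_fun setT
    (EFin \o (fun z : V * R => \1_`[0, h] z.2 * f (z.1 + z.2 *: v))).
  apply/measurable_EFinP; apply: measurable_funM.
    exact: measurable_sweep_indic.
  exact: measurable_sweep.
apply/(integrable21ltyP mu lam mF).
pose C := (\int[mu]_x `|f x|%:E)%E.
have Cfin : (C < +oo)%E by case/integrableP : fi.
rewrite [ltLHS](_ : _ = \int[lam]_s ((\1_`[0, h] s)%:E * C))%E.
  rewrite ge0_integralZr//.
  - by rewrite integral_indic_itv// lte_mul_pinfty.
  - by apply/measurable_EFinP.
  - by apply: integral_ge0 => x _; rewrite lee_fin.
apply: eq_integral => s _.
under eq_integral do rewrite /= normrM EFinM.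
rewrite ge0_integralZl//.
- rewrite ger0_norm//; congr (_ * _)%E.
  apply: (@ge0_integral_preserving _ _ _ mu (fun x => x + s *: v)
    (measurable_shift _) (lebesgue_rV_shift _) (fun x => `|f x|%:E)) => //.
  by apply/measurable_EFinP; exact: measurableT_comp.
- apply/measurable_EFinP; apply: measurableT_comp => //.
  by apply: (measurableT_comp mf); exact: measurable_shift.
Qed.

Lemma integrable_sweepM v w h f psi C : 0 <= h -> mu.-integrable setT (EFin \o f) ->
  measurable_fun setT psi -> (forall x, `|psi x| <= C) ->
  (mu \x lam)%E.-integrable setT
    (EFin \o (fun z => \1_`[0, h] z.2 * f (z.1 + z.2 *: v) * psi (z.1 + z.2 *: w))).
Proof.
move=> h0 fi mpsi psiC.
have gi := integrable_sweep v h0 fi.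
have mf : measurable_fun setT f.
  by apply/measurable_EFinP; exact: measurable_int fi.
apply: le_integrable (integrableZl measurableT C gi) => //.
  apply/measurable_EFinP; apply: measurable_funM; last exact: measurable_sweep.
  by apply: measurable_funM; [exact: measurable_sweep_indic|exact: measurable_sweep].
move=> z _; rewrite /= lee_fin mulrC !normrM ler_wpM2r//.
by rewrite (le_trans (psiC _))// ler_norm.
Qed.

Lemma integrable_line_bounded v h psi C x : measurable_fun setT psi ->
  (forall x, `|psi x| <= C) ->
  lam.-integrable `[0, h] (fun s => (psi (x + s *: v))%:E).
Proof.
move=> mpsi psiC; apply: measurable_bounded_integrable => //.
- exact: lebesgue_itv0_lty.
- apply: measurable_funTS; apply: (measurableT_comp mpsi).
  exact: (measurableT_comp (measurable_line v) (pair1_measurable x)).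
- exists C; split; first exact: num_real.
  by move=> M CM s _; rewrite /= (le_trans (psiC _))// ltW.
Qed.

Lemma line_integral_le v h psi C x : 0 <= h -> measurable_fun setT psi ->
  (forall x, `|psi x| <= C) -> `|line_integral v h psi x| <= C * h.
Proof.
move=> h0 mpsi psiC.
have gi := integrable_line_bounded v h x mpsi psiC.
apply: le_trans (le_normr_Rintegral _ gi) _ => //.
rewrite -(Rintegral_itv0_cst C h0).
apply: le_Rintegral => //.
- exact: integrable_norm.
- exact: integrable_itv0_cst.
Qed.

(** Adding the bound [C] makes the integrand nonnegative, so that the measurability
    part of Tonelli's theorem applies *)
Lemma measurable_line_integral v h psi C : 0 <= h -> measurable_fun setT psi ->
  (forall x, `|psi x| <= C) -> measurable_fun setT (line_integral v h psi).
Proof.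
move=> h0 mpsi psiC.
pose F (z : V * measurableTypeR R) : \bar R :=
  (\1_`[0, h] z.2 * (psi (z.1 + z.2 *: v) + C))%:E.
have mF : measurable_fun setT F.
  apply/measurable_EFinP; apply: measurable_funM; first exact: measurable_sweep_indic.
  by apply: measurable_funD => //; exact: measurable_sweep.
have F0 z : (0 <= F z)%E.
  rewrite lee_fin mulr_ge0// -lerBlDr sub0r.
  by have := psiC (z.1 + z.2 *: v); rewrite ler_norml => /andP[].
have mg := measurable_fun_fubini_tonelli_F (m2 := lam) F mF F0.
rewrite (_ : line_integral v h psi = fun x => fine (fubini_F lam F x) - C * h).
  by apply: measurable_funB => //; exact: (measurableT_comp _ mg).
apply/funext => x; rewrite /fubini_F.
have -> : fine (\int[lam]_y F (x, y))%E = \int[lam]_(s in `[0, h]) (psi (x + s *: v) + C).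
  rewrite [RHS]Rintegral_mkcond; congr fine; apply: eq_integral => s _.
  rewrite /F/= patchE indicE; case: ifP => _; rewrite ?mul1r ?mul0r//.
have gi := integrable_line_bounded v h x mpsi psiC.
rewrite RintegralD//; last exact: integrable_itv0_cst.
by rewrite Rintegral_itv0_cst// addrK.
Qed.

Lemma integrable_line_integral v h f : 0 <= h -> mu.-integrable setT (EFin \o f) ->
  mu.-integrable setT (EFin \o line_integral v h f).
Proof.
move=> h0 fi; have := integrable_Rfubini1 (integrable_sweep v h0 fi).
rewrite (_ : (fun x => _) = EFin \o line_integral v h f)//.
by apply/funext => x /=; rewrite line_integralE.
Qed.

(** Fubini's theorem exchanges the integrations over the space and over the
    parameter of the line. *)
Lemma line_integral_dual1 v h f psi C : 0 <= h -> mu.-integrable setT (EFin \o f) ->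
  measurable_fun setT psi -> (forall x, `|psi x| <= C) ->
  \int[mu]_x (f x * line_integral (- v) h psi x) =
  \int[lam]_s (\1_`[0, h] s * \int[mu]_x (f x * psi (x - s *: v))).
Proof.
move=> h0 fi mpsi psiC.
have Fi := integrable_sweepM 0 (- v) h0 fi mpsi psiC.
transitivity (\int[mu]_x \int[lam]_s
    (\1_`[0, h] s * f (x + s *: 0) * psi (x + s *: - v))).
  apply: eq_Rintegral => x _; rewrite line_integralE -RintegralZl//; last first.
    have gi := integrable_line_bounded (- v) h x mpsi psiC.
    have mI : measurable (`[0, h]%classic : set (measurableTypeR R)) by [].
    have := (integrable_mkcond _ mI).1 gi.
    congr (_.-integrable _ _).
    apply/funext => s /=; rewrite patchE indicE.
    by case: ifP => _; rewrite ?mul1r ?mul0r.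
  by apply: eq_Rintegral => s _; rewrite scaler0 addr0 mulrCA mulrA.
rewrite (Rfubini Fi); apply: eq_Rintegral => s _ /=.
rewrite indicE; case: (s \in _); last first.
  rewrite mul0r; under eq_Rintegral do rewrite !mul0r.
  by rewrite /Rintegral integral0.
rewrite mul1r; apply: eq_Rintegral => x _.
by rewrite mul1r scaler0 addr0 scalerN.
Qed.

(** The translation [x -> x + s *: v] moves the average from one factor to the
    other; averages of the merely integrable factor are thus traded for averages
    of the bounded one. *)
Lemma line_integral_dual v h f psi C : 0 <= h -> mu.-integrable setT (EFin \o f) ->
  measurable_fun setT psi -> (forall x, `|psi x| <= C) ->
  \int[mu]_x (f x * line_integral (- v) h psi x) =
  \int[mu]_x (line_integral v h f x * psi x).
Proof.
move=> h0 fi mpsi psiC; rewrite (line_integral_dual1 v h0 fi mpsi psiC).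
have Fi := integrable_sweepM v 0 h0 fi mpsi psiC.
have mf : measurable_fun setT f.
  by apply/measurable_EFinP; exact: measurable_int fi.
transitivity (\int[mu]_x \int[lam]_s
    (\1_`[0, h] s * f (x + s *: v) * psi (x + s *: 0))); last first.
  congr fine; apply: ae_eq_integral => //.
  - exact: measurable_int (integrable_Rfubini1 Fi).
  - apply/measurable_EFinP; apply: measurable_funM => //.
    by apply/measurable_EFinP; exact: measurable_int (integrable_line_integral v h0 fi).
  - apply: filterS (ae_integrable1 (integrable_sweep v h0 fi)) => x xi _.
    rewrite line_integralE -RintegralZr//; congr (_%:E).
    by apply: eq_Rintegral => s _; rewrite scaler0 addr0.
rewrite (Rfubini Fi); apply: eq_Rintegral => s _ /=.
rewrite indicE; case: (s \in _); last first.
  rewrite mul0r; under [RHS]eq_Rintegral do rewrite !mul0r.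
  by rewrite /Rintegral integral0.
rewrite mul1r; congr fine.
rewrite -(@integral_preserving _ _ _ mu (fun x => x + s *: v)
    (measurable_shift _) (lebesgue_rV_shift _)).
  by apply: eq_integral => x _; rewrite addrK mul1r scaler0 addr0.
apply/measurable_EFinP; apply: measurable_funM => //.
by apply: (measurableT_comp mpsi); exact: measurable_shift.
Qed.

Lemma harmonic_dnbhs : (harmonic : nat -> R) @ \oo --> (0 : R)^'.
Proof.
move=> A; rewrite /dnbhs /within /= => hA.
have h : \forall n \near \oo, (harmonic n : R) != 0 -> A (harmonic n).
  exact: (@cvg_harmonic R _ hA).
suff : \forall n \near \oo, A (harmonic n) by [].
by apply: filterS h => n; apply; rewrite /harmonic invr_eq0 pnatr_eq0.
Qed.

Lemma itv0_shift (g : R -> R) (t h : R) : 0 <= h -> measurable_fun setT g ->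
  \int[lam]_(s in `[t, t + h]) g s = \int[lam]_(s in `[0, h]) g (t + s).
Proof.
move=> h0 mg; rewrite Rintegral_mkcond [RHS]Rintegral_mkcond; congr fine.
have mt : measurable_fun [set: measurableTypeR R] (fun s => s + t : measurableTypeR R).
  exact: measurable_funD.
rewrite -(@integral_preserving _ _ _ lam (fun s => s + t) mt (lebesgue_shift t)).
  apply: eq_integral => s _; rewrite /patch !mem_setE !in_itv/=.
  by rewrite lerDr [in s + t <= _]addrC lerD2l addrC.
have mI : measurable (`[t, t + h]%classic : set (measurableTypeR R)) by [].
apply/measurable_EFinP; apply/(measurable_restrictT g mI).
exact: measurable_funTS.
Qed.

(** The integral along the line is a difference quotient of a primitive of
    [t -> psi (x + t *: v)], and primitives of bounded functions are
    differentiable almost everywhere, with the expected derivative. *)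
Lemma cvg_line_average_1d v psi C x : measurable_fun setT psi ->
  (forall x, `|psi x| <= C) ->
  {ae lam, forall t, 0 <= t ->
    n.+1%:R * line_integral v n.+1%:R^-1 psi (x + t *: v) @[n --> \oo] -->
      psi (x + t *: v)}.
Proof.
move=> mpsi psiC; pose g (t : R) := psi (x + t *: v).
have mg : measurable_fun setT g.
  apply: (measurableT_comp mpsi).
  exact: (measurableT_comp (measurable_line v) (pair1_measurable x)).
have gi (K : set R) : measurable K -> (lam K < +oo)%E -> lam.-integrable K (EFin \o g).
  move=> mK Koo; apply: measurable_bounded_integrable => //.
    exact: measurable_funTS.
  exists C; split; first exact: num_real.
  by move=> M CM s _; rewrite /= (le_trans (psiC _))// ltW.
have gi' y : lam.-integrable [set` Interval (BLeft (-1)) (BRight y)] (EFin \o g).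
  apply: gi => //; rewrite [ltLHS]lebesgue_measure_itv/=.
  by case: ifP => _; rewrite ?ltry.
have lg : locally_integrable [set: R] g.
  split=> //; first exact: openT.
  move=> K _ cK.
  have /integrableP[] := gi K (compact_measurable cK) (compact_finite_measure cK).
  by [].
have [B [mB B0 HB]] := FTC1 gi' lg.
exists B; split => // t /= nt; apply: HB => /= Ht; apply: nt => t0.
have t1 : ((-1)%:E < t%:E :> \bar R)%E by rewrite lte_fin (lt_le_trans _ t0)// ltrN10.
have [dF F't] := Ht t1.
set F := (fun x : R => _) in dF F't.
have FE n : n.+1%:R * line_integral v n.+1%:R^-1 psi (x + t *: v) =
   (harmonic n)^-1 *: ((F \o shift t) (harmonic n *: 1) - F t).
  rewrite /harmonic invrK /GRing.scale/= mulr1 [_^-1 + t]addrC; congr (_ * _).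
  have h0 : 0 <= (n.+1%:R^-1 : R) by rewrite invr_ge0.
  rewrite /F Rintegral_itvB//; last 2 first.
  - by rewrite bnd_simp (le_trans _ t0)// lerN10.
  - by rewrite bnd_simp lerDl.
  rewrite Rintegral_itv_obnd_cbnd; last first.
    by apply: gi => //; rewrite [ltLHS]lebesgue_measure_itv/=; case: ifP => _; rewrite ?ltry.
  rewrite itv0_shift//; apply: eq_Rintegral => s _.
  by rewrite /g -addrA -scalerDl.
under eq_cvg do rewrite FE.
rewrite -[psi _]/(g t) -F't derive1E.
exact: (cvg_comp _ _ harmonic_dnbhs dF).
Qed.

(** Convergence written with countably many operations, which makes the set of
    the points of convergence measurable. *)
Lemma cvg_harmonicP (u : nat -> R) (l : R) : u @ \oo --> l <->
  forall m, exists n, forall k, (n <= k)%N -> `|l - u k| < m.+1%:R^-1.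
Proof.
split=> [/cvgrPdist_lt ul m|H].
  have [n _ Hn] := ul m.+1%:R^-1 (ltac:(by rewrite invr_gt0)).
  by exists n => k nk; exact: Hn.
apply/cvgrPdist_lt => e e0.
have [m me] : exists m, m.+1%:R^-1 < e.
  have [m _ /(_ _ (leqnn _))] := @cvgr_lt _ _ _ _ _ _ (@cvg_harmonic R) _ e0.
  by exists m.
have [n Hn] := H m; exists n => // k nk; exact: lt_trans (Hn k nk) me.
Qed.

(** The differentiation theorem holds at almost every point of each line in the
    direction [v]. The exceptional set has the same measure as its translates by
    [s *: v]; averaging over [s] in [0, 1] and exchanging the integrals shows
    that this measure is zero. *)
Lemma ae_cvg_line_average v psi C : measurable_fun setT psi ->
  (forall x, `|psi x| <= C) ->
  {ae mu, forall x,
    n.+1%:R * line_integral v n.+1%:R^-1 psi x @[n --> \oo] --> psi x}.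
Proof.
move=> mpsi psiC; pose q n x := n.+1%:R * line_integral v n.+1%:R^-1 psi x.
have mq n : measurable_fun setT (q n).
  by apply: measurable_funM => //; apply: measurable_line_integral psiC.
pose A m k := [set x | `|psi x - q k x| < m.+1%:R^-1].
have mA m k : measurable (A m k).
  rewrite -[A m k]setTI; apply: measurable_fun_ltr => //.
  by apply: measurableT_comp => //; exact: measurable_funB.
pose G := \bigcap_m \bigcup_n \bigcap_(k in [set k | (n <= k)%N]) A m k.
have mG : measurable G.
  apply: bigcapT_measurable => m; apply: bigcupT_measurable => n.
  exact: bigcap_measurableType.
have GP x : G x <-> q n x @[n --> \oo] --> psi x.
  split=> [Gx|/cvg_harmonicP H].
    apply/cvg_harmonicP => m; have [n _ Hn] := Gx m I.
    by exists n => k nk; exact: (Hn k nk).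
  by move=> m _; have [n Hn] := H m; exists n.
exists (~` G); split.
- exact: measurableC.
- have mB := measurableC mG.
  pose F (z : V * measurableTypeR R) : \bar R :=
    (\1_`[0, 1] z.2 * \1_(~` G) (z.1 + z.2 *: v))%:E.
  have mF : measurable_fun setT F.
    apply/measurable_EFinP; apply: measurable_funM; first exact: measurable_sweep_indic.
    by apply: measurable_sweep; exact: measurable_indic.
  have F0 z : (0 <= F z)%E by rewrite lee_fin mulr_ge0.
  have := fubini_tonelli (m1 := mu) (m2 := lam) F mF F0.
  have -> : (\int[mu]_x \int[lam]_s F (x, s) = 0)%E.
    apply: integral0_eq => x _.
    have [B [mB' B0 HB]] := cvg_line_average_1d v x mpsi psiC.
    rewrite -[RHS](integral0 lam setT); apply: ae_eq_integral => //.
      exact: (measurableT_comp mF (pair1_measurable x)).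
    exists B; split=> // s /= h; apply: HB => /= Hs; apply: h => _.
    rewrite /F/= !indicE mem_setE in_itv/=; case: (boolP (0 <= s)) => s0; last by rewrite mul0r.
    by rewrite memNset ?mulr0//= => -[]; apply/GP; exact: Hs.
  have -> : (\int[lam]_s \int[mu]_x F (x, s) =
      \int[lam]_s ((\1_`[0%R, 1%R] s)%:E * mu (~` G)))%E.
    apply: eq_integral => s _; rewrite /F/=.
    under eq_integral do rewrite EFinM.
    rewrite ge0_integralZl//.
    + congr (_ * _)%E.
      rewrite (@ge0_integral_preserving _ _ _ mu (fun x => x + s *: v)
        (measurable_shift _) (lebesgue_rV_shift _) (fun x => (\1_(~` G) x)%:E)) //.
      * by rewrite integral_indic// setIT.
      * by apply/measurable_EFinP; exact: measurable_indic.
    + apply/measurable_EFinP.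
      have mi : measurable_fun setT (\1_(~` G) : V -> R) by exact: measurable_indic.
      exact: (measurableT_comp mi (measurable_shift (s *: v))).
  rewrite ge0_integralZr//.
  by rewrite integral_indic_itv// mul1e.
  by apply/measurable_EFinP.
- by move=> x /= h /GP.
Qed.

(** Averages of a bounded function stay under its bound, so that dominated
    convergence applies against the integrable [f]. *)
Lemma cvg_line_average v f psi C : mu.-integrable setT (EFin \o f) ->
  measurable_fun setT psi -> (forall x, `|psi x| <= C) ->
  n.+1%:R * (\int[mu]_x (f x * line_integral v n.+1%:R^-1 psi x)) @[n --> \oo] -->
  \int[mu]_x (f x * psi x).
Proof.
move=> fi mpsi psiC.
have mf : measurable_fun setT f by apply/measurable_EFinP; exact: measurable_int fi.
pose q n x := n.+1%:R * line_integral v n.+1%:R^-1 psi x.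
have h0 n : 0 <= (n.+1%:R^-1 : R) by rewrite invr_ge0.
have mq n : measurable_fun setT (q n).
  by apply: measurable_funM => //; exact: measurable_line_integral psiC.
have qC n x : `|q n x| <= C.
  rewrite /q normrM ger0_norm// mulrC.
  by have := line_integral_le v x (h0 n) mpsi psiC; rewrite ler_pdivlMr.
have fq n : mu.-integrable setT (fun x => (f x * q n x)%:E).
  apply: le_integrable (integrableZl measurableT C fi) => //.
    by apply/measurable_EFinP; exact: measurable_funM.
  move=> x _; rewrite /= lee_fin mulrC [leLHS]normrM [leRHS]normrM ler_wpM2r//.
  by rewrite (le_trans (qC _ _))// ler_norm.
have [|||||fpi _ cv] := @dominated_convergence _ _ _ mu _ measurableT
  (fun n x => (f x * q n x)%:E) (fun x => (f x * psi x)%:E)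
  (fun x => (C%:E * `|(f x)%:E|)%E).
- by move=> n; apply/measurable_EFinP; exact: measurable_funM.
- by apply/measurable_EFinP; exact: measurable_funM.
- apply: filterS (ae_cvg_line_average v mpsi psiC) => x Hx _.
  apply: cvg_EFin; first by near=> n.
  by apply: cvgM; [exact: cvg_cst|exact: Hx].
- by apply: integrableZl => //; exact: integrable_abse.
- by apply: aeW => x n _; rewrite /= lee_fin mulrC [leLHS]normrM ler_wpM2r.
rewrite -(fineK (integrable_fin_num measurableT fpi)) in cv.
apply: cvg_trans (fine_cvg cv); apply: near_eq_cvg; near=> n => /=.
rewrite -RintegralZl//.
  by congr fine; apply: eq_integral => x _; rewrite /q mulrCA.
have := integrableZl measurableT n.+1%:R^-1 (fq n).
congr (_.-integrable _ _); apply/funext => x /=.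
by rewrite -EFinM /q mulrCA mulKf.
Unshelve. all: by end_near. Qed.

End line_average.

(** * Calculus of test functions *)
Section test_function_calculus.
Context {R : realType} {N : nat}.
Local Notation V := 'rV[R]_N.
Local Notation mu := (@lebesgue_rV R N).
Local Notation lam := (@lebesgue_measure R).
Implicit Types (E K W : set V) (phi : V -> R) (x y v w : V) (h c r : R).

Lemma derive_shift phi x v w :
  'D_v (fun z => phi (z + w)) x = 'D_v phi (x + w) /\
  (derivable (fun z => phi (z + w)) x v <-> derivable phi (x + w) v).
Proof.
rewrite /derive /derivable.
have -> : (fun h : R => h^-1 *: (((fun z => phi (z + w)) \o shift x) (h *: v) - phi (x + w)))
  = (fun h : R => h^-1 *: ((phi \o shift (x + w)) (h *: v) - phi (x + w))) => //.
by apply/funext => h /=; rewrite addrA.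
Qed.

Lemma foldr_partial_shift phi w (s : seq 'I_N) :
  foldr (@partial R N) (fun z => phi (z + w)) s =
  (fun z => foldr (@partial R N) phi s (z + w)).
Proof.
elim: s => //= i s ->; apply/funext => x.
by rewrite /partial (derive_shift _ _ _ _).1.
Qed.

Lemma continuous_shift w : continuous (fun z : V => z + w).
Proof.
move=> x; apply: (@continuousD _ _ _ id (fun=> w)); first exact: cvg_id.
exact: cst_continuous.
Qed.

Lemma smooth_shift phi w : smooth phi -> smooth (fun z => phi (z + w)).
Proof.
move=> sphi s /=; rewrite foldr_partial_shift; have [cs ds] := sphi s; split.
  move=> x; apply: (@continuous_comp _ _ _ (fun z : V => z + w)
    (foldr (@partial R N) phi s)); last exact: cs.
  exact: continuous_shift.
by move=> x i; apply/(derive_shift _ _ _ _).2; exact: ds.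
Qed.

Lemma test_function_shift W W' phi w : test_function W phi ->
  (forall x, W x -> W' (x - w)) -> test_function W' (fun z => phi (z + w)).
Proof.
move=> [sphi cK KW] WW'.
pose K := closure [set x | phi x != 0].
have sub : closure [set x | phi (x + w) != 0] `<=` (fun z => z - w) @` K.
  have cl : closed ((fun z => z + w) @^-1` K).
    apply: closed_comp; last exact: closed_closure.
    by move=> x _; exact: continuous_shift.
  move=> x xc; exists (x + w); last by rewrite addrK.
  move: x xc; change (closure [set x | phi (x + w) != 0] `<=` (fun z => z + w) @^-1` K).
  rewrite [X in _ `<=` X](closure_id _).1//; apply: closure_subset => x.
  exact: (@subset_closure _ _ (x + w)).
split; first exact: smooth_shift.
- apply: (subclosed_compact _ _ sub); first exact: closed_closure.
  apply: continuous_compact => //; apply: continuous_subspaceT.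
  exact: continuous_shift.
- by move=> x /sub [z Kz <-]; apply: WW'; exact: KW.
Qed.

(** The fundamental theorem of calculus on a segment. The factor [c], which will
    be a sign, gives access to both orientations of the axis. *)
Lemma test_function_increment E phi i c h x : test_function E phi -> 0 < h ->
  phi (x + h *: (c *: delta_mx 0 i)) - phi x =
  c * line_integral (c *: delta_mx 0 i) h (partial i phi) x.
Proof.
move=> tphi h0; have [cphi dphi cpphi _] := test_function_derive tphi.
pose G (s : R) := phi (x + s *: (c *: delta_mx 0 i)).
pose g (s : R) := c * partial i phi (x + s *: (c *: delta_mx 0 i)).
have cl : continuous (fun s : R => x + s *: (c *: delta_mx 0 i) : V).
  move=> s; apply: (@continuousD _ _ _ (fun=> x) (fun s : R => s *: (c *: delta_mx 0 i))).
    exact: cst_continuous.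
  exact: (@continuousZl _ _ _ id).
have dG (s : R) : is_derive s (1 : R) G (g s).
  have /is_derive_line H : is_derive (x + (c * s) *: delta_mx 0 i) (delta_mx 0 i) phi
      (partial i phi (x + (c * s) *: delta_mx 0 i)).
    by apply: DeriveDef => //; exact: dphi.
  have Hc : is_derive s (1 : R) (fun s : R => c * s) c.
    by apply: is_derive_eq; rewrite /GRing.scale/= mulr1.
  have := @is_derive1_comp _ (fun t : R => phi (x + t *: delta_mx 0 i)) _ s _ _ H Hc.
  rewrite mulrC /g scalerA [s * c]mulrC.
  suff -> : (fun t : R => phi (x + t *: delta_mx 0 i)) \o (fun s : R => c * s) = G by [].
  by apply/funext => t; rewrite /G/= scalerA mulrC.
have cp : continuous (fun s : R => partial i phi (x + s *: (c *: delta_mx 0 i))).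
  move=> s; apply: (@continuous_comp _ _ _ (fun s : R => x + s *: (c *: delta_mx 0 i))
    (partial i phi)); [exact: cl|exact: cpphi].
have cg : continuous g by move=> s; apply: cvgM; [exact: cvg_cst|exact: cp].
have cG : continuous G.
  by move=> s; apply: (@continuous_comp _ _ _ (fun s : R => x + s *: (c *: delta_mx 0 i)) phi);
    [exact: cl|exact: cphi].
have GE : derivable_oo_LRcontinuous G 0 h.
  by split; [move=> s _; case: (dG s)|apply: cvg_at_right_filter; exact: cG
    |apply: cvg_at_left_filter; exact: cG].
have G'g : {in `]0, h[, G^`()%classic =1 g}.
  by move=> s _; rewrite derive1E; case: (dG s).
have := continuous_FTC2 h0 (continuous_subspaceT cg) GE G'g.
rewrite -EFinB /G scale0r addr0 => HF.
have gi : lam.-integrable `[0, h] (fun s => (partial i phi (x + s *: (c *: delta_mx 0 i)))%:E).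
  apply: continuous_compact_integrable; first exact: segment_compact.
  exact: continuous_subspaceT.
by rewrite /line_integral -RintegralZl// /Rintegral HF.
Qed.

Definition thicken K r : set V := [set z | exists2 x, K x & cube x r z].

Lemma open_thicken K r : open (thicken K r).
Proof.
have -> : thicken K r = \bigcup_(x in K) cube x r.
  by apply/seteqP; split=> z; [move=> [x Kx xz]; exists x|move=> [x Kx xz]; exists x].
by apply: bigcup_open => x _; exact: open_cube.
Qed.

Lemma sub_thicken K r : 0 < r -> K `<=` thicken K r.
Proof. by move=> r0 x Kx; exists x => //; exact: cube_center. Qed.

Lemma thicken_cube K r d z w : thicken K r z -> (forall i, `|w 0 i - z 0 i| <= d) ->
  thicken K (r + d) w.
Proof.
move=> [x Kx xz] zw; exists x => // i.
rewrite -(subrKA (z 0 i)) (le_lt_trans (ler_normD _ _))// addrC.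
by rewrite ltr_leD ?xz.
Qed.

(** By compactness, a radius that is good locally can be chosen uniformly. *)
Lemma compact_thicken_sub K E : compact K -> open E -> K `<=` E ->
  exists2 d, 0 < d & thicken K d `<=` E.
Proof.
move=> cK oE KE.
have /compact_near_coveringP ncK := cK.
have H : \forall d \near (0 : R)^'+, K `<=` (fun x => cube x d `<=` E).
  apply: ncK => x Kx.
  have [e /= e0 xeE] := open_subball oE (KE _ Kx).
  near=> y d; apply: (subset_trans _ (xeE (e / 2) _ _)) => /=.
  - rewrite -cube_ball ?divr_gt0// => z yz k.
    have yx : cube x (e / 4) y.
      by near: y; apply: open_nbhs_nbhs; split; [exact: open_cube|
        apply: cube_center; rewrite divr_gt0].
    have de : d < e / 4 by near: d; apply: nbhs_right_lt; rewrite divr_gt0.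
    rewrite -(subrKA (y 0 k)) (le_lt_trans (ler_normD _ _))//.
    by rewrite (lt_le_trans (ltrD (lt_trans (yz k) de) (yx k)))//; lra.
  - by rewrite sub0r normrN gtr0_norm ?divr_gt0// ltr_pdivrMr// ltr_pMr// ltr1n.
  - by rewrite divr_gt0.
have : \forall d \near (0 : R)^'+, 0 < d /\ K `<=` (fun x => cube x d `<=` E).
  by apply: filterI => //; exact: nbhs_right_gt.
move=> /filter_ex[d [d0 Kd]]; exists d => // z [x Kx xz].
exact: Kd xz.
Unshelve. all: by end_near. Qed.

Lemma closure_thicken_sub K r d : 0 < d ->
  closure (thicken K r) `<=` thicken K (r + d).
Proof.
move=> d0 z /(_ (cube z d)) [|w [wK zw]].
  by apply: open_nbhs_nbhs; split; [exact: open_cube|exact: cube_center].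
by apply: thicken_cube wK _ => i; rewrite distrC ltW// zw.
Qed.

Lemma compact_closure_thicken K r : compact K -> compact (closure (thicken K r)).
Proof.
move=> cK; apply: bounded_closed_compact; last exact: closed_closure.
have [M [_ HM]] := compact_bounded cK.
pose B := `|M| + 1 + `|r| + 1.
exists B; split; first exact: num_real.
move=> b Bb z /(closure_thicken_sub ltr01) [x Kx xz].
have b0 : 0 < b by apply: le_lt_trans Bb; rewrite /B !addr_ge0.
have : cube 0 b z.
  move=> i; rewrite mxE subr0; apply: lt_trans Bb.
  rewrite -(subrK (x 0 i) (z 0 i)) (le_lt_trans (ler_normD _ _))//.
  rewrite addrC /B -addrA ler_ltD//.
    apply: le_trans (coord_le_norm _ _) _; apply: HM => //.
    by rewrite ltr_pwDr// ler_norm.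
  by rewrite (lt_le_trans (xz i))// lerD2r ler_norm.
by rewrite cube_ball// -ball_normE /= sub0r normrN => /ltW.
Qed.

(** Finitely many bumps, positive on cubes covering [K], add up to a function with
    a positive minimum on [K]; a multiple of it lies above [phi]. *)
Lemma test_function_dominates K W phi : compact K -> open W -> K `<=` W ->
  continuous phi -> (forall x, ~ K x -> phi x = 0) ->
  exists eta C, [/\ test_function W eta, forall x, 0 <= eta x &
    forall x, `|phi x| <= C * eta x].
Proof.
move=> cK oW KW cphi phi0.
have [d d0 KdW] := compact_thicken_sub cK oW KW.
have d2 : 0 < d / 2 by rewrite divr_gt0.
pose a x : V := x - const_mx (d / 2); pose b x : V := x + const_mx (d / 2).
have abE x : box (a x) (b x) = cube x (d / 2) by rewrite cubeE.
have := cK; rewrite compact_cover => /(_ _ K (fun x => box (a x) (b x))).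
case=> [x _|x Kx|D DK KD]; first exact: open_box.
  by exists x => //; rewrite abE; exact: cube_center.
pose eta z := \sum_(x <- finmap.enum_fset D) bump 1 (a x) (b x) z.
have eeta : elementary eta.
  by apply: elementary_sum => x; exact: elementary_bump.
have eta0 z : 0 <= eta z by apply: sumr_ge0 => x _; exact: bump_ge0.
have teta : test_function W eta.
  have sub : closure [set z | eta z != 0] `<=` closure (thicken K (d / 2)).
    apply: closure_subset => z /= /eqP etaz; apply: contrapT => Kz; apply: etaz.
    rewrite /eta big_seq big1// => x xD; apply: bump_eq0; rewrite abE => xz.
    by apply: Kz; exists x => //; apply: set_mem; exact: DK.
  split; first exact: elementary_smooth.
  - apply: (subclosed_compact _ (compact_closure_thicken (r := d / 2) cK)) => //.
    exact: closed_closure.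
  - apply: subset_trans sub _; apply: subset_trans KdW.
    by have := @closure_thicken_sub K (d / 2) (d / 2) d2; rewrite -splitr.
have [C1 C10 HC1] := compact_bounded_fun cK cphi.
have [[x0 Kx0]|K0] := pselect (K !=set0); last first.
  exists eta, 0; split=> // x; rewrite phi0 ?normr0 ?mul0r// => Kx.
  by apply: K0; exists x.
have [c cK' Hc] : exists2 c, c \in K & forall t, t \in K -> eta c <= eta t.
  apply: EVT_min_rV => //; first by exists x0.
  by apply: continuous_subspaceT; exact: elementary_continuous.
have etac : 0 < eta c.
  have [x /= xD xc] := KD _ (set_mem cK').
  rewrite /eta (big_rem x)//= ltr_pwDl ?bump_gt0//.
  by apply: sumr_ge0 => z _; exact: bump_ge0.
exists eta, (C1 / eta c); split=> // x.
have [Kx|Kx] := pselect (K x); last first.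
  by rewrite phi0// normr0 mulr_ge0// divr_ge0// ltW.
rewrite (le_trans (HC1 _ Kx))// mulrAC ler_pdivlMr// ler_wpM2l//.
by apply: Hc; exact: mem_set.
Qed.

End test_function_calculus.

(** * The chain rule for truncations *)
Section chain_rule.
Context {R : realType} {N : nat}.
Local Notation V := 'rV[R]_N.
Local Notation mu := (@lebesgue_rV R N).
Local Notation lam := (@lebesgue_measure R).
Implicit Types (E K W : set V) (f phi : V -> R) (x y z : V) (h c r : R).

Lemma test_bounded W phi : test_function W phi ->
  exists C : R, forall x, `|phi x| <= C.
Proof.
move=> tphi; have [cphi _ _ phi0] := test_function_derive tphi.
have [_ cK _] := tphi; have [C C0 HC] := compact_bounded_fun cK cphi.
exists C => x; have [/HC//|Kx] := pselect (closure [set x | phi x != 0] x).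
by rewrite (phi0 x Kx).1 normr0.
Qed.

Lemma test_partial_bounded W phi i : test_function W phi ->
  exists C : R, forall x, `|partial i phi x| <= C.
Proof.
move=> tphi; have [_ _ cphi phi0] := test_function_derive tphi.
have [_ cK _] := tphi; have [C C0 HC] := compact_bounded_fun cK (cphi i).
exists C => x; have [/HC//|Kx] := pselect (closure [set x | phi x != 0] x).
by rewrite (phi0 x Kx).2 normr0.
Qed.

Lemma test_measurable W phi : test_function W phi -> measurable_fun setT phi.
Proof. by case/test_function_derive => cphi *; exact: continuous_measurable_rV. Qed.

Lemma test_partial_measurable W phi i : test_function W phi ->
  measurable_fun setT (partial i phi).
Proof. by case/test_function_derive => _ _ cphi _; exact: continuous_measurable_rV. Qed.

Lemma integrable_mul_bounded f (psi : V -> R) C : mu.-integrable setT (EFin \o f) ->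
  measurable_fun setT psi -> (forall x, `|psi x| <= C) ->
  mu.-integrable setT (EFin \o (fun x => f x * psi x)).
Proof.
move=> fi mpsi psiC; have mf : measurable_fun setT f.
  by apply/measurable_EFinP; exact: measurable_int fi.
apply: le_integrable (integrableZl measurableT C fi) => //.
  by apply/measurable_EFinP; exact: measurable_funM.
move=> x _; rewrite /= lee_fin mulrC [leLHS]normrM [leRHS]normrM ler_wpM2r//.
by rewrite (le_trans (psiC _))// ler_norm.
Qed.

Lemma integrable_shift f (v : V) : mu.-integrable setT (EFin \o f) ->
  mu.-integrable setT (EFin \o (fun x => f (x + v))).
Proof.
by move=> fi; have := integrable_preserving (measurable_shift v) (lebesgue_rV_shift v) fi.
Qed.

Lemma Rintegral_shift f (v : V) : measurable_fun setT f ->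
  \int[mu]_x f (x + v) = \int[mu]_x f x.
Proof.
move=> mf; congr fine.
apply: (integral_preserving (measurable_shift v) (lebesgue_rV_shift v) (f := EFin \o f)).
exact/measurable_EFinP.
Qed.

(* [w] is a convex function of [u], with the subgradient [a]. The functions are
   integrable on the whole space, while the derivative [g] of [u] is tested in [W]
   only; test functions supported in [W2] stay supported in [W] when translated by
   at most [d]. *)
Context (W W2 : set V) (oW2 : open W2) (d : R) (d0 : 0 < d).
Context (W2W : forall x z, W2 x -> (forall i, `|z 0 i - x 0 i| <= d) -> W z).
Context (i : 'I_N) (u g w a : V -> R).
Context (ui : mu.-integrable setT (EFin \o u)) (gi : mu.-integrable setT (EFin \o g)).
Context (wi : mu.-integrable setT (EFin \o w)).
Context (ma : measurable_fun setT a) (a1 : forall x, `|a x| <= 1).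
Context (weak : forall phi, test_function W phi ->
  \int[mu]_x (u x * partial i phi x) = - \int[mu]_x (g x * phi x)).
Context (subgrad : forall x z, W x -> W z -> a x * (u z - u x) <= w z - w x).

Let e c : V := c *: delta_mx 0 i.

Let e_le c h k : `|c| = 1 -> 0 <= h <= d -> `|(h *: e c) 0 k| <= d.
Proof.
move=> c1 /andP[h0 hd]; rewrite !mxE eqxx/= normrM normrM c1 mul1r (ger0_norm h0).
rewrite (le_trans _ hd)// ler_piMr//.
by case: (k == i); rewrite ?normr1 ?normr0.
Qed.

Let test_shift phi c h : `|c| = 1 -> 0 <= h <= d -> test_function W2 phi ->
  test_function W (fun z => phi (z - h *: e c)).
Proof.
move=> c1 hd tphi; apply: (test_function_shift tphi) => x Wx.
apply: W2W Wx _ => k; rewrite mxE [X in `|X|](_ : _ = (h *: e c) 0 k).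
  exact: e_le.
by rewrite opprK mxE addrAC subrr add0r.
Qed.

Let eN c : - e c = e (- c).
Proof. by rewrite /e scaleNr. Qed.

(** The translation is moved onto [phi], whose increment is an integral of its
    partial derivative *)
Let int_increment f phi c h : mu.-integrable setT (EFin \o f) ->
  test_function W2 phi -> 0 < h ->
  \int[mu]_x ((f (x + h *: e c) - f x) * phi x) =
  - c * \int[mu]_x (f x * line_integral (- e c) h (partial i phi) x).
Proof.
move=> fi tphi h0.
have mf : measurable_fun setT f by apply/measurable_EFinP; exact: measurable_int fi.
have [C HC] := test_bounded tphi; have mphi := test_measurable tphi.
have [C' HC'] := test_partial_bounded i tphi.
have mpphi := test_partial_measurable i tphi.
have msphi v : measurable_fun setT (fun x => phi (x + v)).
  exact: (measurableT_comp mphi (measurable_shift v)).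
transitivity (\int[mu]_x (f x * phi (x - h *: e c)) - \int[mu]_x (f x * phi x)).
  under eq_Rintegral do rewrite mulrBl.
  rewrite RintegralB//; last 2 first.
    exact: (integrable_mul_bounded (integrable_shift _ fi) mphi HC).
    exact: (integrable_mul_bounded fi mphi HC).
  congr (_ - _); rewrite -[RHS](Rintegral_shift (h *: e c)); last exact: measurable_funM.
  by apply: eq_Rintegral => x _; rewrite addrK.
rewrite -RintegralB//; last 2 first.
  by apply: (integrable_mul_bounded fi (msphi _)) => x; exact: HC.
  exact: (integrable_mul_bounded fi mphi HC).
rewrite -RintegralZl//.
  apply: eq_Rintegral => x _; rewrite -mulrBr -scalerN eN mulrCA.
  by rewrite (test_function_increment i (- c) x tphi h0).
apply: (integrable_mul_bounded (C := C' * h) fi).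
  by apply: measurable_line_integral HC'; rewrite // ltW.
by move=> x; apply: line_integral_le => //; exact: ltW.
Qed.

Let test_zero phi x : test_function W2 phi -> ~ W2 x -> phi x = 0.
Proof.
move=> tphi W2x; have [_ _ _ /(_ x) phi0] := test_function_derive tphi.
by have [_ _ KW] := tphi; apply: (phi0 _).1 => /KW.
Qed.

(** Weakly differentiable functions are integrals of their derivatives along almost
    all segments: tested with [phi], this is the definition of the weak derivative
    for the translates of [phi], averaged along the segment. *)
Let increment_ae c h : `|c| = 1 -> 0 < h -> h <= d ->
  {ae mu, forall x, W2 x -> u (x + h *: e c) - u x - c * line_integral (e c) h g x = 0}.
Proof.
move=> c1 h0 hd; have h0' := ltW h0.
have lgi : mu.-integrable setT (EFin \o (fun x => c * line_integral (e c) h g x)).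
  have := integrableZl measurableT c (integrable_line_integral (e c) h0' gi).
  by congr (_.-integrable _ _); apply/funext => x.
have dui : mu.-integrable setT (EFin \o (fun x => u (x + h *: e c) - u x)).
  have := integrableB measurableT (integrable_shift (h *: e c) ui) ui.
  by congr (_.-integrable _ _); apply/funext => x.
have fi : mu.-integrable setT (EFin \o (fun x =>
    u (x + h *: e c) - u x - c * line_integral (e c) h g x)).
  have := integrableB measurableT dui lgi.
  by congr (_.-integrable _ _); apply/funext => x.
apply: du_bois_reymond => //.
  apply/(Lploc1P _ oW2); split.
    by apply: measurable_funTS; apply/measurable_EFinP; exact: measurable_int fi.
  move=> K cK _; apply: integrableS fi => //; exact: compact_measurable_rV.
move=> phi tphi.
have [C HC] := test_bounded tphi; have mphi := test_measurable tphi.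
have [C' HC'] := test_partial_bounded i tphi.
have mpphi := test_partial_measurable i tphi.
rewrite Rintegral_mkcond.
transitivity (\int[mu]_x ((u (x + h *: e c) - u x) * phi x -
    c * line_integral (e c) h g x * phi x)).
  apply: eq_Rintegral => x _; rewrite patchE; case: ifPn => [_|/negP W2x].
    by rewrite mulrBl.
  by rewrite (test_zero tphi) ?mulr0 ?subr0// => ?; apply: W2x; exact: mem_set.
rewrite RintegralB//; last 2 first.
- exact: (integrable_mul_bounded dui mphi HC).
- exact: (integrable_mul_bounded lgi mphi HC).
rewrite (int_increment c ui tphi h0).
rewrite (line_integral_dual1 (e c) h0' ui mpphi HC').
have Ngi : mu.-integrable setT (EFin \o (fun x => - g x)).
  have := integrableN gi.
  by congr (_.-integrable _ _); apply/funext => x.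
have NRint f' : mu.-integrable setT (EFin \o f') ->
    \int[mu]_x (- f' x) = - \int[mu]_x f' x.
  move=> f'i; rewrite -mulN1r -RintegralZl//.
  by apply: eq_Rintegral => x _; rewrite mulN1r.
have -> : \int[lam]_s (\1_`[0, h] s * \int[mu]_x (u x * partial i phi (x - s *: e c))) =
  \int[lam]_s (\1_`[0, h] s * \int[mu]_x (- g x * phi (x - s *: e c))).
  apply: eq_Rintegral => s _; rewrite indicE mem_setE in_itv/=.
  case: (boolP (0 <= s <= h)) => [/andP[s0 sh]|_]; last by rewrite !mul0r.
  have sd : 0 <= s <= d by rewrite s0 (le_trans sh).
  have tsphi := test_shift c1 sd tphi.
  have [C'' HC''] := test_bounded tsphi; have msphi := test_measurable tsphi.
  rewrite !mul1r; transitivity (- \int[mu]_x (g x * phi (x - s *: e c))).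
    rewrite -(weak tsphi).
    by apply: eq_Rintegral => x _; rewrite /partial (derive_shift _ _ _ _).1.
  rewrite -NRint; last exact: (integrable_mul_bounded gi msphi HC'').
  by apply: eq_Rintegral => x _; rewrite mulNr.
rewrite -(line_integral_dual1 (e c) h0' Ngi mphi HC).
have lphiC x : `|line_integral (- e c) h phi x| <= C * h by exact: line_integral_le.
have mlphi := measurable_line_integral (- e c) h0' mphi HC.
have -> : \int[mu]_x (- g x * line_integral (- e c) h phi x) =
   - \int[mu]_x (g x * line_integral (- e c) h phi x).
  rewrite -NRint; last exact: (integrable_mul_bounded gi mlphi lphiC).
  by apply: eq_Rintegral => x _; rewrite mulNr.
rewrite (line_integral_dual (e c) h0' gi mphi HC) mulrNN -RintegralZl//; last first.
  exact: (integrable_mul_bounded (integrable_line_integral (e c) h0' gi) mphi HC).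
by apply/eqP; rewrite subr_eq0; apply/eqP; apply: eq_Rintegral => x _; rewrite mulrA.
Qed.

Let defect c h x := (w (x + h *: e c) - w x) - a x * (u (x + h *: e c) - u x).

Let integrable_increment f c h : mu.-integrable setT (EFin \o f) ->
  mu.-integrable setT (EFin \o (fun x => f (x + h *: e c) - f x)).
Proof.
move=> fi; have := integrableB measurableT (integrable_shift (h *: e c) fi) fi.
by congr (_.-integrable _ _); apply/funext => x.
Qed.

Let integrable_defect c h : mu.-integrable setT (EFin \o defect c h).
Proof.
have := integrableB measurableT (integrable_increment c h wi)
  (integrable_mul_bounded (integrable_increment c h ui) ma a1).
by congr (_.-integrable _ _); apply/funext => x; rewrite /= /defect mulrC.
Qed.

Let int_defect phi c h : `|c| = 1 -> 0 < h -> h <= d -> test_function W2 phi ->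
  \int[mu]_x (defect c h x * phi x) =
  - c * (\int[mu]_x (w x * line_integral (- e c) h (partial i phi) x) +
         \int[mu]_x (g x * line_integral (- e c) h (fun x => a x * phi x) x)).
Proof.
move=> c1 h0 hd tphi.
have [C HC] := test_bounded tphi; have mphi := test_measurable tphi.
have aphiC x : `|a x * phi x| <= C.
  by rewrite normrM (le_trans _ (HC x))// ler_piMl.
have maphi : measurable_fun setT (fun x => a x * phi x) by exact: measurable_funM.
transitivity (\int[mu]_x ((w (x + h *: e c) - w x) * phi x) -
    \int[mu]_x ((u (x + h *: e c) - u x) * (a x * phi x))).
  rewrite -RintegralB//; last 2 first.
  - exact: (integrable_mul_bounded (integrable_increment c h wi) mphi HC).
  - exact: (integrable_mul_bounded (integrable_increment c h ui) maphi aphiC).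
  by apply: eq_Rintegral => x _; rewrite /defect; ring.
rewrite (int_increment c wi tphi h0) mulrDr; congr (_ + _).
rewrite mulNr; congr (- _); have h0' := ltW h0.
rewrite (line_integral_dual (e c) h0' gi maphi aphiC) -RintegralZl//; last first.
  exact: (integrable_mul_bounded (integrable_line_integral (e c) h0' gi) maphi aphiC).
have lgi := integrable_mul_bounded (integrable_line_integral (e c) h0' gi) maphi aphiC.
congr fine; apply: ae_eq_integral => //.
- exact: measurable_int (integrable_mul_bounded (integrable_increment c h ui) maphi aphiC).
- exact: measurable_int (integrableZl measurableT c lgi).
- apply: filterS (increment_ae c1 h0 hd) => x Hx _; congr (_%:E).
  have [W2x|W2x] := pselect (W2 x).
    have -> : u (x + h *: e c) - u x = c * line_integral (e c) h g x.
      by apply/eqP; rewrite -subr_eq0; apply/eqP; exact: Hx.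
    by rewrite -mulrA.
  by rewrite (test_zero tphi)// !mulr0.
Qed.

(** The defect is of order [h], and its leading term is odd in [c] *)
Let cvg_defect phi c : `|c| = 1 -> test_function W2 phi ->
  n.+1%:R * \int[mu]_x (defect c n.+1%:R^-1 x * phi x) @[n --> \oo] -->
  - c * (\int[mu]_x (w x * partial i phi x) + \int[mu]_x (g x * (a x * phi x))).
Proof.
move=> c1 tphi.
have [C HC] := test_bounded tphi; have mphi := test_measurable tphi.
have [C' HC'] := test_partial_bounded i tphi.
have mpphi := test_partial_measurable i tphi.
have aphiC x : `|a x * phi x| <= C.
  by rewrite normrM (le_trans _ (HC x))// ler_piMl.
have maphi : measurable_fun setT (fun x => a x * phi x) by exact: measurable_funM.
have H1 := cvg_line_average (- e c) wi mpphi HC'.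
have H2 := cvg_line_average (- e c) gi maphi aphiC.
have H3 := cvgM (cvg_cst (- c)) (cvgD H1 H2).
apply: cvg_trans (H3 _ _ _); apply: near_eq_cvg.
have hd : \forall n \near \oo, (n.+1%:R^-1 : R) < d.
  exact: (cvgr_lt _ (@cvg_harmonic R) _ d0).
near=> n; rewrite int_defect//.
- by rewrite !fctE /= -mulrDr mulrCA.
- by rewrite ltW//; near: n.
Unshelve. all: by end_near. Qed.

Let defect_ge0 c h x : `|c| = 1 -> 0 < h -> h <= d -> W2 x -> 0 <= defect c h x.
Proof.
move=> c1 h0 hd W2x; rewrite subr_ge0; apply: subgrad.
  by apply: (W2W W2x) => k; rewrite subrr normr0 ltW.
apply: (W2W W2x) => k; rewrite [X in `|X|](_ : _ = (h *: e c) 0 k).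
  by apply: e_le => //; rewrite (ltW h0) hd.
by rewrite mxE addrAC subrr add0r.
Qed.

(** The limit of the defects against a nonnegative test function has the sign of
    [c] and of [- c], hence vanishes. A test function of any sign is bounded by a
    nonnegative one, so its limit is squeezed to zero too. *)
Lemma chain_rule_local phi : test_function W2 phi ->
  \int[mu]_x (w x * partial i phi x) = - \int[mu]_x (g x * (a x * phi x)).
Proof.
pose L phi := \int[mu]_x (w x * partial i phi x) + \int[mu]_x (g x * (a x * phi x)).
have hd : \forall n \near \oo, (n.+1%:R^-1 : R) < d.
  exact: (cvgr_lt _ (@cvg_harmonic R) _ d0).
have L_ge0 eta c : `|c| = 1 -> test_function W2 eta -> (forall x, 0 <= eta x) ->
    0 <= - c * L eta.
  move=> c1 teta eta0; apply: cvgr_to_ge (cvg_defect c1 teta) _.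
  near=> n; rewrite mulr_ge0//; apply: Rintegral_ge0 => x _.
  have [W2x|W2x] := pselect (W2 x); last by rewrite (test_zero teta)// mulr0.
  by rewrite mulr_ge0//; apply: defect_ge0 => //; rewrite ltW//; near: n.
have L_eq0 eta : test_function W2 eta -> (forall x, 0 <= eta x) -> L eta = 0.
  move=> teta eta0; apply/eqP; rewrite eq_le.
  have := L_ge0 eta 1 (normr1 _) teta eta0.
  have := L_ge0 eta (-1) (normrN1 _) teta eta0.
  by rewrite opprK mul1r mulN1r oppr_ge0 => -> ->.
move=> tphi; apply/eqP; rewrite -addr_eq0 -/(L phi).
have [cphi _ _ phi0] := test_function_derive tphi; have [_ cK KW2] := tphi.
have phi0' x (Kx : ~ _) := (phi0 x Kx).1.
have [eta [C [teta eta0 HC]]] := test_function_dominates cK oW2 KW2 cphi phi0'.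
have c1 : `|1 : R| = 1 by exact: normr1.
have H1 := cvg_norm (cvg_defect c1 tphi).
have H2 := cvgM (cvg_cst C) (cvg_defect c1 teta).
rewrite -/(L phi) in H1; rewrite -/(L eta) (L_eq0 _ teta eta0) !mulr0 in H2.
have : `|- 1 * L phi| <= 0; last by rewrite mulN1r normrN normr_le0.
apply: ler_cvg_to (H1 _) (H2 _ _) _; near=> n => /=.
have [Ceta HCeta] := test_bounded teta; have meta := test_measurable teta.
have [Cphi HCphi] := test_bounded tphi; have mphi := test_measurable tphi.
have h0 : 0 < (n.+1%:R^-1 : R) by rewrite invr_gt0.
have hn : (n.+1%:R^-1 : R) <= d by rewrite ltW//; near: n.
have iphi := integrable_mul_bounded (integrable_defect 1 n.+1%:R^-1) mphi HCphi.
have ieta := integrable_mul_bounded (integrable_defect 1 n.+1%:R^-1) meta HCeta.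
rewrite normrM ger0_norm// mulrCA ler_wpM2l// -RintegralZl//.
apply: le_trans (le_normr_Rintegral _ iphi) _ => //.
apply: le_Rintegral => //.
- exact: integrable_norm iphi.
- have := integrableZl measurableT C ieta.
  by congr (_.-integrable _ _); apply/funext => x.
move=> x _; have [W2x|W2x] := pselect (W2 x); last first.
  by rewrite (test_zero tphi)// (test_zero teta)// !mulr0 normr0.
have D0 := defect_ge0 c1 h0 hn W2x.
by rewrite normrM (ger0_norm D0) mulrCA ler_wpM2l.
Unshelve. all: by end_near. Qed.

End chain_rule.

Section truncation.
Context {R : realType} {N : nat}.
Local Notation V := 'rV[R]_N.
Local Notation mu := (@lebesgue_rV R N).
Implicit Types (E K W : set V) (f u phi : V -> R) (g : V -> V) (x y z : V) (k : R).

Lemma funrneg_subr u k x : (u \- cst k)^\- x = Num.max (k - u x) 0.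
Proof. by rewrite /funrneg /= opprB. Qed.

Lemma measurable_sublevel E u k : open E -> measurable_fun E u ->
  measurable (E `&` [set x | u x <= k]).
Proof.
move=> /open_measurable_rV mE mu_.
have := mu_ mE `]-oo, k]%classic (measurable_itv _).
by congr (measurable (_ `&` _)); apply/seteqP; split=> x /=; rewrite in_itv.
Qed.

Lemma indic_sublevel E u k x : E x ->
  \1_(E `&` [set x | u x <= k]) x = (u x <= k)%R%:R :> R.
Proof.
move=> Ex; rewrite indicE; have [ux|ux] := boolP (u x <= k); first by rewrite mem_set.
by rewrite memNset// => -[_] /=; apply/negP.
Qed.

Lemma Lploc1_funrneg E u k : open E -> Lploc 1 E u -> Lploc 1 E (u \- cst k)^\-.
Proof.
move=> oE /(Lploc1P _ oE)[mu_ ui]; apply/(Lploc1P _ oE); split.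
  rewrite (_ : _^\- = fun x => Num.max (k - u x) 0).
    by apply: measurable_maxr => //; exact: measurable_funB.
  by apply/funext => x; rewrite funrneg_subr.
move=> K cK KE; have mK := compact_measurable_rV cK.
have ki : mu.-integrable K (fun=> k%:E).
  apply: measurable_bounded_integrable => //; first exact: compact_lebesgue_lty.
  exists `|k|; split; first exact: num_real.
  by move=> M kM x _; exact: ltW.
apply: le_integrable (integrableB mK ki (ui K cK KE)) => //.
  apply/measurable_EFinP; rewrite (_ : _^\- = fun x => Num.max (k - u x) 0).
    apply: measurable_maxr => //; apply: measurable_funB => //.
    exact: measurable_funS (open_measurable_rV oE) KE mu_.
  by apply/funext => x; rewrite funrneg_subr.
move=> x _; rewrite /= lee_fin funrneg_subr.
by case: (leP (k - u x) 0) => [_|/ltW h0]; rewrite ?normr0.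
Qed.

Lemma Lploc1_sublevel E u f k : open E -> measurable_fun E u -> Lploc 1 E f ->
  Lploc 1 E (fun x => - (u x <= k)%R%:R * f x).
Proof.
move=> oE mu_ /(Lploc1P _ oE)[mf fi].
have mE := open_measurable_rV oE.
have mA := measurable_sublevel k oE mu_.
have mg : measurable_fun E (fun x => - (u x <= k)%R%:R * f x).
  apply: measurable_funM => //; apply: measurableT_comp => //.
  apply: (@eq_measurable_fun _ _ _ _ _ (\1_(E `&` [set x | u x <= k]) : V -> R)).
    by move=> x /set_mem Ex; exact: indic_sublevel.
  by apply: measurable_funTS; exact: measurable_indic.
apply/(Lploc1P _ oE); split=> // K cK KE.
have mK := compact_measurable_rV cK.
apply: le_integrable (fi K cK KE) => //.
  by apply/measurable_EFinP; exact: measurable_funS mE KE mg.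
move=> x _; rewrite /= lee_fin normrM ler_piMl// normrN.
by case: (u x <= k); rewrite ?normr1 ?normr0.
Qed.

(** The function [t -> max (k - t) 0] is convex, and [- 1] is one of its
    subgradients at each [t <= k], including the kink [t = k]. The statement to
    prove is local, so [u] and its gradient are cut off outside a neighbourhood
    of the support of the test function. *)
Lemma is_weak_gradient_funrneg E u g k : open E -> is_weak_gradient E u g ->
  is_weak_gradient E (u \- cst k)^\- (fun x => - (u x <= k)%R%:R *: g x).
Proof.
move=> oE [uL gL Hug]; have mE := open_measurable_rV oE.
have mu_ : measurable_fun E u by case: uL.
split; first exact: Lploc1_funrneg.
  move=> i; rewrite (_ : (fun x => _) = fun x => - (u x <= k)%R%:R * g x 0 i).
    exact: Lploc1_sublevel.
  by apply/funext => x; rewrite mxE.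
move=> phi tphi i; have [sphi cK KE] := tphi.
pose K := closure [set x | phi x != 0].
have [d1 d10 d1E] := compact_thicken_sub cK oE KE.
(* The closure of W, the thickening by 2d, is in the thickening by 3d and a fortiori
   in E, where u is locally integrable *)
pose d : R := d1 / 4; have d0 : 0 < d by rewrite divr_gt0.
pose W2 := thicken K d; pose W := thicken K (d + d).
have oW2 : open W2 by exact: open_thicken.
have mW : measurable W by apply: open_measurable_rV; exact: open_thicken.
have KW2 : K `<=` W2 by exact: sub_thicken.
have W2W x z : W2 x -> (forall j, `|z 0 j - x 0 j| <= d) -> W z.
  by move=> W2x zx; exact: thicken_cube W2x zx.
have cW : compact (closure W) by exact: compact_closure_thicken.
have cWE : closure W `<=` E.
  move=> z /(closure_thicken_sub d0)[x Kx xz].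
  apply: d1E; exists x => // j; rewrite (lt_le_trans (xz j))// /d; lra.
have WE : W `<=` E by apply: subset_trans cWE; exact: subset_closure.
have tphi2 : test_function W2 phi by split.
have localize f : Lploc 1 E f -> mu.-integrable setT (EFin \o (f \_ W)).
  move=> fL; have fi := Lploc1_integrable oE fL cW cWE.
  rewrite (_ : EFin \o (f \_ W) = (EFin \o f) \_ W); last by rewrite restrict_EFin.
  apply/(integrable_mkcond _ mW); apply: integrableS fi => //.
    exact: compact_measurable_rV.
  exact: subset_closure.
have intW f psi : (forall x, ~ W x -> psi x = 0) ->
    \int[mu]_(x in E) (f x * psi x) = \int[mu]_x ((f \_ W) x * psi x).
  move=> psi0; rewrite Rintegral_mkcond; apply: eq_Rintegral => x _.
  rewrite /patch; have [Wx|Wx] := pselect (W x).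
    by rewrite !mem_set//; exact: WE.
  by rewrite psi0// !mulr0 if_same.
have test0 psi j : test_function W psi ->
    (forall x, ~ W x -> psi x = 0) /\ (forall x, ~ W x -> partial j psi x = 0).
  move=> tpsi; have [_ _ _ psi0] := test_function_derive tpsi.
  have [_ _ KW] := tpsi.
  by split=> x Wx; [apply: (psi0 x _).1 => /KW|apply: (psi0 x _).2 => /KW].
pose A := E `&` [set x | u x <= k].
have mA : measurable A by exact: measurable_sublevel.
pose a x : R := - \1_A x.
have ma : measurable_fun setT a.
  by apply: measurableT_comp => //; exact: measurable_indic.
have a1 x : `|a x| <= 1.
  by rewrite /a normrN indicE; case: (_ \in _); rewrite ?normr1 ?normr0.
have aE x : E x -> a x = - (u x <= k)%R%:R.
  by move=> Ex; rewrite /a indic_sublevel.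
have weak psi : test_function W psi ->
    \int[mu]_x ((u \_ W) x * partial i psi x) =
    - \int[mu]_x (((fun x => g x 0 i) \_ W) x * psi x).
  move=> tpsi; have [psi0 ppsi0] := test0 _ i tpsi.
  rewrite -!intW//; apply: Hug; case: tpsi => spsi cpsi psiW; split=> //.
  exact: subset_trans WE.
have subgrad x z : W x -> W z ->
    a x * ((u \_ W) z - (u \_ W) x) <=
    ((u \- cst k)^\- \_ W) z - ((u \- cst k)^\- \_ W) x.
  move=> Wx Wz; rewrite /patch !mem_set// !funrneg_subr aE; last exact: WE.
  case: (leP (u x) k) => h /=.
    by case: (leP (k - u x) 0); case: (leP (k - u z) 0); lra.
  by case: (leP (k - u x) 0); case: (leP (k - u z) 0); lra.
have H := chain_rule_local oW2 d0 W2W (localize _ uL) (localize _ (gL i))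
  (localize _ (Lploc1_funrneg k oE uL)) ma a1 weak subgrad tphi2.
have W2W' x : ~ W x -> ~ W2 x.
  by move=> Wx W2x; apply: Wx; apply: (W2W x) => // j; rewrite subrr normr0 ltW.
have tphiW : test_function W phi.
  by split=> // x Kx; apply: contrapT => /W2W'; apply; exact: KW2.
have [phi0 pphi0] := test0 _ i tphiW.
rewrite intW// H; congr (- _).
rewrite intW//; apply: eq_Rintegral => x _; rewrite /patch.
case: ifPn => [/set_mem Wx|_]; last by rewrite !mul0r.
by rewrite mxE aE; [ring|exact: WE].
Qed.

Lemma weak_gradientP E u : (exists g, is_weak_gradient E u g) ->
  is_weak_gradient E u (weak_gradient E u).
Proof. by move=> [g ug]; apply: (@xgetPex _ _ (is_weak_gradient E u)); exists g. Qed.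

(** The chosen weak gradient of the truncation agrees almost everywhere with the
    one exhibited above. *)
Lemma ae_weak_gradient_funrneg E u k : open E ->
  (exists g, is_weak_gradient E u g) ->
  {ae mu, forall x, E x -> weak_gradient E (u \- cst k)^\- x =
    - (u x <= k)%R%:R *: weak_gradient E u x}.
Proof.
move=> oE /weak_gradientP ug; have uk := is_weak_gradient_funrneg k oE ug.
apply: (weak_gradient_ae_unique oE) (uk); apply: weak_gradientP.
by exists (fun x => - (u x <= k)%R%:R *: weak_gradient E u x).
Qed.

End truncation.

(** * One-dimensional weights *)
Section weights.
Context {R : realType}.
Local Notation lam := (@lebesgue_measure R).
Implicit Types (t k M p : R).

Let FTC2 (F f : R -> R) t M : 0 < t -> t <= M ->
  (forall k, 0 < k -> is_derive k (1 : R) F (f k)) ->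
  (forall k, 0 < k -> {for k, continuous f}) ->
  (\int[lam]_(k in `[t, M]) (f k)%:E = (F M - F t)%:E)%E.
Proof.
move=> t0; rewrite le_eqVlt => /predU1P[<-|tM] dF cf.
  by rewrite set_itv1 integral_set1 subrr.
have cF k : 0 < k -> {for k, continuous F}.
  move=> k0; apply: differentiable_continuous; apply/derivable1_diffP.
  by case: (dF k k0).
rewrite (continuous_FTC2 tM (F := F)) ?EFinB//.
- apply: continuous_in_subspaceT => k; rewrite inE/= in_itv/= => /andP[tk _].
  by apply: cf; exact: lt_le_trans tk.
- split.
  + by move=> k; rewrite in_itv/= => /andP[tk _]; case: (dF k (lt_trans t0 tk)).
  + by apply: cvg_at_right_filter; exact: cF.
  + by apply: cvg_at_left_filter; apply: cF; exact: lt_trans tM.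
- move=> k; rewrite in_itv/= => /andP[tk _]; rewrite derive1E.
  by case: (dF k (lt_trans t0 tk)).
Qed.

Lemma integral_powRN t M p : 0 < t -> t <= M -> 0 < p ->
  (\int[lam]_(k in `[t, M]) (k `^ (- p - 1))%:E =
    ((t `^ (- p) - M `^ (- p)) / p)%:E)%E.
Proof.
move=> t0 tM p0.
have d k q : 0 < k -> is_derive k (1 : R) (fun k : R => k `^ q) (q * k `^ (q - 1)).
  by move=> k0; exact: is_derive1_powR.
have dF k : 0 < k -> is_derive k (1 : R) (fun k : R => - p^-1 * k `^ (- p))
    (k `^ (- p - 1)).
  move=> k0; apply: is_derive_eq (is_deriveZ (- p^-1) (d k (- p) k0)) _.
  by rewrite /GRing.scale/= mulrA mulrNN mulVf ?mul1r// gt_eqF.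
have cf k : 0 < k -> {for k, continuous (fun k : R => k `^ (- p - 1))}.
  move=> k0; apply: differentiable_continuous; apply/derivable1_diffP.
  by case: (d k (- p - 1) k0).
rewrite (FTC2 t0 tM dF cf); congr (_%:E); field.
by rewrite gt_eqF.
Qed.

Let continuous_inv_sub t k : 0 < k -> {for k, continuous (fun k : R => k^-1 - t * k ^- 2)}.
Proof.
move=> k0; have k0' : k != 0 by rewrite gt_eqF.
apply: cvgB; first exact: inv_continuous.
apply: cvgM; first exact: cvg_cst.
by apply: cvgV; [rewrite expf_neq0|exact: exprn_continuous].
Qed.

Lemma integral_inv_sub t M : 0 < t -> t <= M ->
  (\int[lam]_(k in `[t, M]) (k^-1 - t * k ^- 2)%:E =
    (ln (M / t) - (1 - t / M))%:E)%E.
Proof.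
move=> t0 tM; have M0 := lt_le_trans t0 tM.
have dV k : 0 < k -> is_derive k (1 : R) (fun s : R => s^-1) (- k ^- 2).
  move=> k0; apply: is_derive_eq (is_deriveV _ _) _ => //=; first by rewrite gt_eqF.
  by rewrite /GRing.scale/= mulr1.
have dF k : 0 < k -> is_derive k (1 : R) (fun k : R => ln k + t * k^-1)
    (k^-1 - t * k ^- 2).
  move=> k0.
  apply: is_derive_eq (is_deriveD (is_derive1_ln k0) (is_deriveZ t (dV k k0))) _.
  by rewrite /GRing.scale/= mulrN.
rewrite (FTC2 t0 tM dF (@continuous_inv_sub t)); congr (_%:E); rewrite ln_div ?posrE//; field.
by rewrite !gt_eqF.
Qed.

Lemma powR_le_id v p : 0 <= v -> v <= 1 -> 1 <= p -> v `^ p <= v.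
Proof.
rewrite le_eqVlt => /predU1P[<- _ p1|v0 v1 p1]; last by rewrite ge1r_powR// v0.
by rewrite powR0// gt_eqF// (lt_le_trans _ p1).
Qed.

Lemma powR_sub_ratio t k p : 0 < k -> t <= k ->
  (k - t) `^ p * k `^ (- p) = (1 - t / k) `^ p.
Proof.
move=> k0 tk; have k0' : k != 0 by rewrite gt_eqF.
have v0 : 0 <= 1 - t / k by rewrite subr_ge0 ler_pdivrMr// mul1r.
have -> : k - t = k * (1 - t / k) by rewrite mulrBr mulr1 mulrCA mulfV// mulr1.
rewrite powRM//; last exact: ltW.
have kp : k `^ p != 0 by rewrite gt_eqF// powR_gt0.
by rewrite powRN mulrAC mulfV// mul1r.
Qed.

(** The left-hand side is [(1 - t / k)^p / k], and the right-hand side is the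
    same expression with [p = 1], whose primitive is elementary. *)
Lemma powR_ratio_le t k p : 0 < k -> t <= k -> 0 <= t -> 1 <= p ->
  (k - t) `^ p * k `^ (- p - 1) <= k^-1 - t * k ^- 2.
Proof.
move=> k0 tk t0 p1; have k0' : k != 0 by rewrite gt_eqF.
have -> : k^-1 - t * k ^- 2 = (1 - t / k) * k^-1 by field.
rewrite powRD; last by rewrite k0' implybT.
rewrite powR_inv1 ?(ltW k0)// mulrA powR_sub_ratio// ler_wpM2r ?invr_ge0 ?(ltW k0)//.
apply: powR_le_id => //.
  by rewrite subr_ge0 ler_pdivrMr// mul1r.
by rewrite gerBl divr_ge0// ltW.
Qed.

(** Up to the factor [p], the weight that integration over the levels below [M]
    puts on the gradient at a point where [u = t]. *)
Definition level_integral M p t : \bar R :=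
  (\int[lam]_(k in `]0%R, M[) (if t <= k then k `^ (- p - 1) else 0)%R%:E)%E.

(** Up to the factor [p], the weight that the truncations themselves produce at a
    point where [u = t]. *)
Definition excess_integral M p t : \bar R :=
  (\int[lam]_(k in `]0%R, M[) (Num.max (k - t) 0 `^ p * k `^ (- p - 1))%:E)%E.

Lemma measurable_powR_cst q (D : set (measurableTypeR R)) :
  measurable_fun D (fun k : R => k `^ q).
Proof. by apply: measurable_funTS; exact: measurable_powR. Qed.

Lemma level_integralE M p t : 0 < t -> t <= M -> 0 < p ->
  (p%:E * level_integral M p t + (M `^ (- p))%:E = (t `^ (- p))%:E)%E.
Proof.
move=> t0 tM p0; rewrite /level_integral.
have -> : (\int[lam]_(k in `]0%R, M[) (if t <= k then k `^ (- p - 1) else 0)%R%:E =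
    \int[lam]_(k in `[t, M[) (k `^ (- p - 1))%:E)%E.
  rewrite integral_mkcond [RHS]integral_mkcond; apply: eq_integral => k _.
  rewrite /patch !mem_setE !in_itv/=; case: (leP t k) => tk /=; last by rewrite if_same.
  by rewrite (lt_le_trans t0 tk).
rewrite integral_itv_bndo_bndc; last by apply/measurable_EFinP; exact: measurable_powR_cst.
rewrite integral_powRN// -EFinM -EFinD; congr (_%:E); field.
by rewrite gt_eqF.
Qed.

Lemma lne_div_gt0 M t : 0 < M -> 0 < t ->
  (lne (M%:E / t%:E) = (ln (M / t))%:E)%E.
Proof. by move=> M0 t0; rewrite inver gt_eqF// -EFinM /= leNgt divr_gt0. Qed.

(** Comparison with the case [p = 1] leaves [(p - 1) * (1 - t / M)] to spare. For
    [t = 0] the right-hand side is infinite. *)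
Lemma excess_integral_le M p t : 0 < M -> 0 <= t -> t <= M -> 1 < p ->
  (p%:E * excess_integral M p t + (Num.max (M - t) 0 `^ p * M `^ (- p))%:E <=
   p%:E * lne (M%:E / t%:E))%E.
Proof.
move=> M0; rewrite le_eqVlt => /predU1P[<- _ p1|t0 tM p1].
  have p0 : 0 < p by exact: lt_trans p1.
  by rewrite inve0 gt0_muley ?lte_fin//= gt0_muley ?lte_fin// leey.
have p0 : 0 < p by exact: lt_trans p1.
rewrite lne_div_gt0//.
have H : (excess_integral M p t <= (ln (M / t) - (1 - t / M))%:E)%E.
  rewrite -integral_inv_sub// /excess_integral.
  have -> : (\int[lam]_(k in `]0%R, M[) (Num.max (k - t) 0 `^ p * k `^ (- p - 1))%:E =
      \int[lam]_(k in `[t, M[) ((k - t) `^ p * k `^ (- p - 1))%:E)%E.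
    rewrite integral_mkcond [RHS]integral_mkcond; apply: eq_integral => k _.
    rewrite /patch !mem_setE !in_itv/=; case: (leP t k) => tk /=.
      by rewrite (lt_le_trans t0 tk)/= max_l// subr_ge0.
    rewrite max_r; last by rewrite subr_le0 ltW.
    by rewrite powR0 ?gt_eqF// mul0r if_same.
  have m1 (D : set (measurableTypeR R)) :
      measurable_fun D (fun k : R => ((k - t) `^ p * k `^ (- p - 1))%:E).
    apply/measurable_EFinP; apply: measurable_funM; last exact: measurable_powR_cst.
    apply: measurable_funTS; apply: (measurableT_comp (measurable_powR p)).
    exact: measurable_funB.
  rewrite integral_itv_bndo_bndc; last exact: m1.
  apply: ge0_le_integral => //.
  - by move=> k _; rewrite lee_fin mulr_ge0 ?powR_ge0.
  - apply/measurable_EFinP; apply: subspace_continuous_measurable_fun => //.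
    apply: continuous_in_subspaceT => k; rewrite inE/= in_itv/= => /andP[tk _].
    by apply: continuous_inv_sub; exact: lt_le_trans tk.
  - move=> k /=; rewrite in_itv/= => /andP[tk _]; rewrite lee_fin.
    by apply: powR_ratio_le => //; rewrite ?(lt_le_trans t0 tk)// ltW.
rewrite max_l ?subr_ge0// powR_sub_ratio//.
have v0 : 0 <= 1 - t / M by rewrite subr_ge0 ler_pdivrMr// mul1r.
have v1 : 1 - t / M <= 1 by rewrite gerBl divr_ge0// ltW.
have vp := powR_le_id v0 v1 (ltW p1).
apply: (@le_trans _ _ (p%:E * (ln (M / t) - (1 - t / M))%:E + ((1 - t / M) `^ p)%:E)%E).
  by rewrite leeD2r// lee_wpmul2l// lee_fin ltW.
rewrite -EFinM -EFinD -EFinM lee_fin; nra.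
Qed.

End weights.

(** * Integration over the levels *)
Section layers.
Context {R : realType} {N : nat}.
Local Notation V := 'rV[R]_N.
Local Notation mu := (@lebesgue_rV R N).
Local Notation lam := (@lebesgue_measure R).
Implicit Types (E X Y : set V) (u G : V -> R) (k M p C : R).

Lemma tonelli_on X (I : set (measurableTypeR R)) (H : V * measurableTypeR R -> \bar R) :
  measurable X -> measurable I -> measurable_fun setT H -> (forall z, 0 <= H z)%E ->
  (\int[mu]_(x in X) \int[lam]_(k in I) H (x, k) =
   \int[lam]_(k in I) \int[mu]_(x in X) H (x, k))%E.
Proof.
move=> mX mI mH H0.
have mXI : measurable (X `*` I) by exact: measurableX.
have mH' : measurable_fun setT (H \_ (X `*` I)).
  by apply/(measurable_restrictT _ mXI); exact: measurable_funTS.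
have H'0 z : (0 <= (H \_ (X `*` I)) z)%E by rewrite patchE; case: ifP.
have := fubini_tonelli (m1 := mu) (m2 := lam) _ mH' H'0.
rewrite [X in X = _ -> _](_ : _ = \int[mu]_(x in X) \int[lam]_(k in I) H (x, k))%E.
  rewrite [X in _ = X -> _](_ : _ = \int[lam]_(k in I) \int[mu]_(x in X) H (x, k))%E.
    by [].
  rewrite [RHS]integral_mkcond; apply: eq_integral => k _.
  rewrite [RHS]patchE; case: ifPn => [/set_mem kI|/negP kI].
    rewrite [RHS]integral_mkcond; apply: eq_integral => x _.
    rewrite /patch; congr (if _ then _ else _); apply/idP/idP.
      by move=> /set_mem[/= Xx _]; exact: mem_set.
    by move=> /set_mem Xx; exact: mem_set.
  apply: integral0_eq => x _; rewrite patchE memNset// => -[_ /= Ik].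
  by apply: kI; exact: mem_set.
rewrite [RHS]integral_mkcond; apply: eq_integral => x _.
rewrite [RHS]patchE; case: ifPn => [/set_mem xX|/negP xX].
  rewrite [RHS]integral_mkcond; apply: eq_integral => k _.
  rewrite /patch; congr (if _ then _ else _); apply/idP/idP.
    by move=> /set_mem[/= _ Ik]; exact: mem_set.
  by move=> /set_mem Ik; exact: mem_set.
apply: integral0_eq => k _; rewrite patchE memNset// => -[/= Xx _].
by apply: xX; exact: mem_set.
Qed.

Lemma measurable_integral_snd (I : set (measurableTypeR R))
    (H : V * measurableTypeR R -> \bar R) : measurable I ->
  measurable_fun setT H -> (forall z, 0 <= H z)%E ->
  measurable_fun setT (fun x => \int[lam]_(k in I) H (x, k))%E.
Proof.
move=> mI mH H0; have mTI : measurable ([set: V] `*` I) by exact: measurableX.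
have mH' : measurable_fun setT (H \_ ([set: V] `*` I)).
  by apply/(measurable_restrictT _ mTI); exact: measurable_funTS.
have H'0 z : (0 <= (H \_ ([set: V] `*` I)) z)%E by rewrite patchE; case: ifP.
have := measurable_fun_fubini_tonelli_F (m2 := lam) _ mH' H'0.
congr measurable_fun; apply/funext => x; rewrite /fubini_F [RHS]integral_mkcond.
apply: eq_integral => k _; rewrite /patch; congr (if _ then _ else _).
by apply/idP/idP => [/set_mem[/= _ Ik]|/set_mem Ik]; exact: mem_set.
Qed.

Lemma measurable_integral_fst X (H : V * measurableTypeR R -> \bar R) :
  measurable X -> measurable_fun setT H -> (forall z, 0 <= H z)%E ->
  measurable_fun setT (fun k => \int[mu]_(x in X) H (x, k))%E.
Proof.
move=> mX mH H0; have mXT : measurable (X `*` [set: measurableTypeR R]).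
  exact: measurableX.
have mH' : measurable_fun setT (H \_ (X `*` [set: measurableTypeR R])).
  by apply/(measurable_restrictT _ mXT); exact: measurable_funTS.
have H'0 z : (0 <= (H \_ (X `*` [set: measurableTypeR R])) z)%E.
  by rewrite patchE; case: ifP.
have := measurable_fun_fubini_tonelli_G (m1 := mu) _ mH' H'0.
congr measurable_fun; apply/funext => k; rewrite /fubini_G [RHS]integral_mkcond.
apply: eq_integral => x _; rewrite /patch; congr (if _ then _ else _).
by apply/idP/idP => [/set_mem[/= Xx _]|/set_mem Xx]; exact: mem_set.
Qed.

(** Tonelli's theorem for the estimates at the levels in ]0, M[ with the weight
    [p * k^(-p-1)], to which the estimate at the level [M] is added with the
    weight [M^(-p)]. The point mass at [M] is what completes the power
    [u^(-p)]. *)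
Lemma integral_levels X Y u G C M p : measurable X -> measurable Y ->
  measurable_fun setT u -> measurable_fun setT G -> (forall x, 0 <= G x) ->
  0 <= C -> 0 < M -> 0 < p ->
  (forall k, 0 < k -> k <= M ->
    (\int[mu]_(x in X) (if u x <= k then G x else 0)%R%:E <=
    C%:E * \int[mu]_(x in Y) (Num.max (k - u x) 0 `^ p)%:E)%E) ->
  (\int[mu]_(x in X) (p%:E * ((G x)%:E * level_integral M p (u x)) +
     ((if (u x <= M)%R then G x else 0) * M `^ (- p))%:E) <=
   C%:E * \int[mu]_(x in Y) (p%:E * excess_integral M p (u x) +
     (Num.max (M - u x) 0 `^ p * M `^ (- p))%:E))%E.
Proof.
move=> mX mY mu_ mG G0 C0 M0 p0 Hk.
pose I : set (measurableTypeR R) := `]0, M[%classic.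
pose w k : R := k `^ (- p - 1).
pose H1 (z : V * measurableTypeR R) : \bar R :=
  ((if u z.1 <= z.2 then G z.1 else 0) * w z.2)%:E.
pose H2 (z : V * measurableTypeR R) : \bar R :=
  (Num.max (z.2 - u z.1) 0 `^ p * w z.2)%:E.
have w0 k : 0 <= w k by exact: powR_ge0.
have mw : measurable_fun setT w by exact: measurable_powR_cst.
have mI : measurable I by rewrite /I.
have p0' : 0 <= p by exact: ltW.
have mlev k : measurable_fun setT (fun x => if u x <= k then G x else 0).
  by apply: measurable_fun_ifT => //; exact: measurable_fun_ler.
have lev0 k x : 0 <= (if u x <= k then G x else 0) by case: ifP.
have mexc k : measurable_fun setT (fun x => Num.max (k - u x) 0 `^ p).
  apply: (measurableT_comp (measurable_powR p)); apply: measurable_maxr => //.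
  exact: measurable_funB.
have mu1 : measurable_fun setT (fun z : V * measurableTypeR R => u z.1).
  exact: (measurableT_comp mu_ measurable_fst).
have mw2 : measurable_fun setT (fun z : V * measurableTypeR R => w z.2).
  exact: (measurableT_comp mw measurable_snd).
have mH1 : measurable_fun setT H1.
  apply/measurable_EFinP; apply: measurable_funM => //.
  apply: measurable_fun_ifT => //; first exact: measurable_fun_ler.
  exact: (measurableT_comp mG measurable_fst).
have mH2 : measurable_fun setT H2.
  apply/measurable_EFinP; apply: measurable_funM => //.
  apply: (measurableT_comp (measurable_powR p)); apply: measurable_maxr => //.
  exact: measurable_funB.
have H10 z : (0 <= H1 z)%E by rewrite lee_fin mulr_ge0.
have H20 z : (0 <= H2 z)%E by rewrite lee_fin mulr_ge0// powR_ge0.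
have M0' : 0 <= M `^ (- p) by exact: powR_ge0.
have E1 x : ((G x)%:E * level_integral M p (u x) = \int[lam]_(k in I) H1 (x, k))%E.
  rewrite /level_integral -ge0_integralZl//.
  - apply: eq_integral => k _; rewrite /H1/= -EFinM; congr (_%:E).
    by case: ifP => _; rewrite ?mulr0 ?mul0r.
  - apply/measurable_EFinP; apply: measurable_funTS; apply: measurable_fun_ifT => //.
    exact: measurable_fun_ler.
  - by move=> k _; rewrite lee_fin; case: ifP => // _; exact: powR_ge0.
  - by rewrite lee_fin.
have mT1 := measurable_integral_snd mI mH1 H10.
have mT2 := measurable_integral_snd mI mH2 H20.
have mS1 := measurable_integral_fst mX mH1 H10.
have mS2 := measurable_integral_fst mY mH2 H20.
have slice k : I k -> (\int[mu]_(x in X) H1 (x, k) <=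
    C%:E * \int[mu]_(x in Y) H2 (x, k))%E.
  rewrite /I/= in_itv/= => /andP[k0 kM].
  have -> : (\int[mu]_(x in X) H1 (x, k) =
      \int[mu]_(x in X) (if u x <= k then G x else 0)%R%:E * (w k)%:E)%E.
    rewrite -ge0_integralZr//.
    - by apply/measurable_EFinP; exact: measurable_funTS.
    - by move=> x _; rewrite lee_fin.
    - by rewrite lee_fin.
  have -> : (\int[mu]_(x in Y) H2 (x, k) =
      \int[mu]_(x in Y) (Num.max (k - u x) 0 `^ p)%:E * (w k)%:E)%E.
    rewrite -ge0_integralZr//.
    - by apply/measurable_EFinP; exact: measurable_funTS.
    - by move=> x _; rewrite lee_fin powR_ge0.
    - by rewrite lee_fin.
  by rewrite muleA lee_wpmul2r ?lee_fin// Hk// ltW.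
have swap : (\int[mu]_(x in X) \int[lam]_(k in I) H1 (x, k) <=
    C%:E * \int[mu]_(x in Y) \int[lam]_(k in I) H2 (x, k))%E.
  rewrite !tonelli_on// -ge0_integralZl//; last 2 first.
  - exact: measurable_funTS.
  - by move=> k _; apply: integral_ge0.
  apply: ge0_le_integral => //.
  - by move=> k _; apply: integral_ge0.
  - exact: measurable_funTS.
  - by apply: measurable_funTS; exact: measurable_funeM.
have top : (\int[mu]_(x in X) ((if (u x <= M)%R then G x else 0) * M `^ (- p))%:E <=
    C%:E * \int[mu]_(x in Y) (Num.max (M - u x) 0 `^ p * M `^ (- p))%:E)%E.
  under eq_integral do rewrite EFinM.
  rewrite ge0_integralZr//; last 2 first.
  - by apply/measurable_EFinP; exact: measurable_funTS.
  - by move=> x _; rewrite lee_fin.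
  under [X in (_ <= _ * X)%E]eq_integral do rewrite EFinM.
  rewrite ge0_integralZr//; last 2 first.
  - by apply/measurable_EFinP; exact: measurable_funTS.
  - by move=> x _; rewrite lee_fin powR_ge0.
  by rewrite muleA lee_wpmul2r ?lee_fin// Hk.
under eq_integral do rewrite E1.
rewrite ge0_integralD//; last 4 first.
- by move=> x _; rewrite mule_ge0 ?lee_fin// integral_ge0.
- by apply: measurable_funTS; exact: measurable_funeM.
- by move=> x _; rewrite lee_fin mulr_ge0.
- by apply/measurable_EFinP; apply: measurable_funTS; exact: measurable_funM.
rewrite [X in (_ <= _ * X)%E]ge0_integralD//; last 4 first.
- by move=> x _; rewrite mule_ge0 ?lee_fin// integral_ge0// => k _; exact: (H20 (x, k)).
- by apply: measurable_funTS; exact: measurable_funeM.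
- by move=> x _; rewrite lee_fin mulr_ge0// powR_ge0.
- by apply/measurable_EFinP; apply: measurable_funTS; exact: measurable_funM.
rewrite ge0_muleDr; last 2 first.
- by apply: integral_ge0 => x _; rewrite mule_ge0 ?lee_fin// integral_ge0// => k _; exact: (H20 (x, k)).
- by apply: integral_ge0 => x _; rewrite lee_fin mulr_ge0// powR_ge0.
apply: leeD top.
rewrite ge0_integralZl//; last 2 first.
- exact: measurable_funTS.
- by move=> x _; apply: integral_ge0.
rewrite [X in (_ <= _ * X)%E]ge0_integralZl//; last 2 first.
- exact: measurable_funTS mT2.
- by move=> x _; apply: integral_ge0 => k _; exact: (H20 (x, k)).
by rewrite muleCA lee_wpmul2l ?lee_fin.
Qed.

Lemma measurable_level_integral M p u : measurable_fun setT u ->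
  measurable_fun setT (fun x => level_integral M p (u x)).
Proof.
move=> mu_; pose H (z : V * measurableTypeR R) : \bar R :=
  (if u z.1 <= z.2 then z.2 `^ (- p - 1) else 0)%:E.
have mu1 : measurable_fun setT (fun z : V * measurableTypeR R => u z.1).
  exact: (measurableT_comp mu_ measurable_fst).
apply: (@measurable_integral_snd _ H) => //; last first.
  by move=> z; rewrite lee_fin; case: ifP => // _; exact: powR_ge0.
apply/measurable_EFinP; apply: measurable_fun_ifT => //.
  exact: measurable_fun_ler.
exact: (measurableT_comp (measurable_powR _) measurable_snd).
Qed.

Lemma measurable_excess_integral M p u : measurable_fun setT u ->
  measurable_fun setT (fun x => excess_integral M p (u x)).
Proof.
move=> mu_; pose H (z : V * measurableTypeR R) : \bar R :=
  (Num.max (z.2 - u z.1) 0 `^ p * z.2 `^ (- p - 1))%:E.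
have mu1 : measurable_fun setT (fun z : V * measurableTypeR R => u z.1).
  exact: (measurableT_comp mu_ measurable_fst).
apply: (@measurable_integral_snd _ H) => //; last first.
  by move=> z; rewrite lee_fin mulr_ge0 ?powR_ge0.
apply/measurable_EFinP; apply: measurable_funM; last first.
  exact: (measurableT_comp (measurable_powR _) measurable_snd).
apply: (measurableT_comp (measurable_powR p)); apply: measurable_maxr => //.
exact: measurable_funB.
Qed.

Lemma enormZ (c : R) (v : V) : enorm (c *: v) = `|c| * enorm v.
Proof.
rewrite /enorm -sqrtr_sqr -sqrtrM ?sqr_ge0// mulr_sumr.
by congr Num.sqrt; apply: eq_bigr => i _; rewrite mxE exprMn.
Qed.

Lemma measurable_enorm_powR E (g : V -> V) p :
  (forall i, measurable_fun E (fun x => g x 0 i)) ->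
  measurable_fun E (fun x => enorm (g x) `^ p).
Proof.
move=> mg; apply: (measurableT_comp (measurable_powR p)).
rewrite (_ : (fun x => _) = fun x => (\sum_i g x 0 i ^+ 2) `^ 2^-1).
  apply: (measurableT_comp (measurable_powR _)); apply: measurable_sum => i.
  exact: measurable_funX.
by apply/funext => x; rewrite powR12_sqrt//; apply: sumr_ge0 => i _; exact: sqr_ge0.
Qed.

Lemma measurable_lne_div M : 0 < M ->
  measurable_fun setT (fun s : R => lne (M%:E / s%:E)%E).
Proof.
move=> M0; rewrite (_ : (fun s : R => _) = fun s : R =>
    if s == 0 then +oo%E else if s < 0 then -oo%E else (ln M - ln s)%:E).
  apply: measurable_fun_ifT => //; first exact: measurable_fun_eqr.
  apply: measurable_fun_ifT => //; first exact: measurable_fun_ltr.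
  by apply/measurable_EFinP; apply: measurable_funB => //; exact: measurable_ln.
apply/funext => s; rewrite inver; case: eqP => [|/eqP] s0.
  by rewrite gt0_muley ?lte_fin.
rewrite -EFinM /= pmulr_rle0// invr_le0 le_eqVlt (negbTE s0)/=.
by case: (ltP s 0) => // s0'; rewrite ln_div// posrE lt_neqAle eq_sym s0.
Qed.

(** In this form the left-hand sides at the various levels involve one and the
    same function [Du], so they can be integrated in [k]. *)
Lemma DGminus_levels E u p gamma y rho r k : open E -> 0 < p ->
  DGminus p E gamma u -> 0 < rho -> rho < r -> cube y r `<=` E ->
  (\int[mu]_(x in cube y rho)
      (if (u x <= k)%R then enorm (weak_gradient E u x) `^ p else 0)%:E <=
   (gamma / (r - rho) `^ p)%:E *
     \int[mu]_(x in cube y r) (Num.max (k - u x) 0 `^ p)%:E)%E.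
Proof.
move=> oE p0 [[_ eg _] DG] rho0 rhor yE.
have := DG y rho r k rho0 rhor yE.
have yrhoE : cube y rho `<=` E.
  by apply: subset_trans yE => x xy i; exact: lt_trans rhor.
have mE := open_measurable_rV oE.
have mrho : measurable (cube y rho) by apply: open_measurable_rV; exact: open_cube.
have ug := weak_gradientP eg.
have ukg := weak_gradientP (ex_intro _ _ (is_weak_gradient_funrneg k oE ug)).
have mgrad w : is_weak_gradient E w (weak_gradient E w) ->
    measurable_fun (cube y rho) (fun x => enorm (weak_gradient E w x) `^ p).
  move=> [_ wL _]; apply: measurable_enorm_powR => i.
  by apply: measurable_funS mE yrhoE _; case: (wL i).
rewrite (@ae_eq_integral _ _ _ mu (cube y rho) (fun x =>
    (if u x <= k then enorm (weak_gradient E u x) `^ p else 0)%:E)); first last.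
- apply: filterS (ae_weak_gradient_funrneg k oE eg) => x Hx yx.
  rewrite Hx; last exact: yrhoE.
  rewrite enormZ normrN; case: (u x <= k); first by rewrite normr1 mul1r.
  by rewrite normr0 mul0r powR0// gt_eqF.
- apply/measurable_EFinP; apply: measurable_fun_if => //.
  + apply: measurable_fun_ler => //; apply: measurable_funS mE yrhoE _.
    by case: ug => -[].
  + by apply: measurable_funS (mgrad u ug) => //; exact: subIsetl.
- by apply/measurable_EFinP; exact: mgrad.
- exact: mrho.
- congr (_ <= _ * _)%E; apply: eq_integral => x _; rewrite funrneg_subr ger0_norm//.
  by rewrite le_max lexx orbT.
Qed.

End layers.

Theorem proposition3p1 (R : realType) (N : nat) (E : set 'rV[R]_N)
  (p gamma M : R) (u : 'rV[R]_N -> R)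
  (E_open : open E) (p_gt1 : 1 < p) (gamma_gt0 : 0 < gamma)
  (uDG : DGminus p E gamma u) (M_gt0 : 0 < M)
  (u_bounded : {ae @lebesgue_rV R N, forall x, E x -> 0 <= u x <= M})
  (y : 'rV[R]_N) (rho r : R) (rho_gt0 : 0 < rho) (rho_lt_r : rho < r)
  (cubeE : cube y r `<=` E) :
  (\int[@lebesgue_rV R N]_(x in cube y rho)
      (enorm ((u x)^-1 *: weak_gradient E u x) `^ p)%:E <=
   (gamma * p / (r - rho) `^ p)%:E *
     \int[@lebesgue_rV R N]_(x in cube y r) lne (M%:E / (u x)%:E))%E.
Proof.
have p0 : 0 < p by exact: lt_trans p_gt1.
have p0' := ltW p0; have mE := open_measurable_rV E_open.
have [[uL eg _] _] := uDG; have [_ gL _] := weak_gradientP eg.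
have yrhoE : cube y rho `<=` E.
  by apply: subset_trans cubeE => x xy i; exact: lt_trans rho_lt_r.
have mX : measurable (cube y rho) by apply: open_measurable_rV; exact: open_cube.
have mY : measurable (cube y r) by apply: open_measurable_rV; exact: open_cube.
set X := cube y rho in yrhoE mX *; set Y := cube y r in mY *.
(* u and its gradient are measurable on E only *)
pose v := u \_ E; pose G := (fun x => enorm (weak_gradient E u x) `^ p) \_ E.
have vE x : E x -> v x = u x by move=> Ex; rewrite /v patchE mem_set.
have GE x : E x -> G x = enorm (weak_gradient E u x) `^ p.
  by move=> Ex; rewrite /G patchE mem_set.
have mv : measurable_fun setT v.
  by apply/(measurable_restrictT _ mE); case: uL.
have mG : measurable_fun setT G.
  apply/(measurable_restrictT _ mE); apply: measurable_enorm_powR => i.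
  by case: (gL i).
have G0 x : 0 <= G x by rewrite /G patchE; case: ifP => // _; exact: powR_ge0.
pose C := gamma / (r - rho) `^ p.
have C0 : 0 <= C by rewrite divr_ge0 ?powR_ge0// ltW.
have levels k : 0 < k -> k <= M ->
    (\int[@lebesgue_rV R N]_(x in X) (if v x <= k then G x else 0)%R%:E <=
     C%:E * \int[@lebesgue_rV R N]_(x in Y) (Num.max (k - v x) 0 `^ p)%:E)%E.
  move=> _ _; have H := DGminus_levels k E_open p0 uDG rho_gt0 rho_lt_r cubeE.
  rewrite (eq_integral (fun x =>
    (if u x <= k then enorm (weak_gradient E u x) `^ p else 0)%:E)); last first.
    by move=> x /set_mem /yrhoE Ex; rewrite vE ?GE.
  rewrite [X in (_ <= _ * X)%E](eq_integral (fun x => (Num.max (k - u x) 0 `^ p)%:E)).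
    exact: H.
  by move=> x /set_mem /cubeE Ex; rewrite vE.
have main := integral_levels mX mY mv mG G0 C0 M_gt0 p0 levels.
have mlevel := measurable_level_integral M p mv.
have mexcess := measurable_excess_integral M p mv.
have lev0 t : (0 <= level_integral M p t)%E.
  by apply: integral_ge0 => k _; rewrite lee_fin; case: ifP => // _; exact: powR_ge0.
have exc0 t : (0 <= excess_integral M p t)%E.
  by apply: integral_ge0 => k _; rewrite lee_fin mulr_ge0 ?powR_ge0.
have M0' : 0 <= M `^ (- p) by exact: powR_ge0.
have top0 x : 0 <= (if v x <= M then G x else 0) * M `^ (- p).
  by rewrite mulr_ge0//; case: ifP.
have lower : (\int[@lebesgue_rV R N]_(x in X)
      (enorm ((u x)^-1 *: weak_gradient E u x) `^ p)%:E <=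
    \int[@lebesgue_rV R N]_(x in X) (p%:E * ((G x)%:E * level_integral M p (v x)) +
     ((if (v x <= M)%R then G x else 0) * M `^ (- p))%:E))%E.
  rewrite (eq_integral (fun x => (`|v x| `^ (- p) * G x)%:E)); last first.
    move=> x /set_mem /yrhoE Ex; rewrite enormZ vE// GE//; congr (_%:E).
    rewrite powRM//; last exact: sqrtr_ge0.
    by congr (_ * _); rewrite normfV -powR_inv1// -powRrM mulN1r.
  apply: ae_ge0_le_integral => //.
  - by move=> x _; rewrite lee_fin mulr_ge0 ?powR_ge0.
  - apply/measurable_EFinP; apply: measurable_funTS; apply: measurable_funM => //.
    apply: (measurableT_comp (measurable_powR _)).
    exact: measurableT_comp.
  - by move=> x _; rewrite adde_ge0 ?mule_ge0// lee_fin.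
  - apply: measurable_funTS; apply: emeasurable_funD.
      apply: measurable_funeM; apply: emeasurable_funM => //.
      exact/measurable_EFinP.
    apply/measurable_EFinP; apply: measurable_funM => //.
    by apply: measurable_fun_ifT => //; exact: measurable_fun_ler.
  - apply: filterS u_bounded => x ux /yrhoE Ex; have := ux Ex.
    rewrite -(vE x Ex) => /andP[v0 vM]; move: v0; rewrite le_eqVlt.
    (* where u = 0 the inverse of u is 0, and so is the integrand on the left *)
    move=> /predU1P[v0|v0].
      rewrite -{1}v0 normr0 powR0 ?oppr_eq0 ?gt_eqF// mul0r.
      by rewrite adde_ge0 ?mule_ge0// lee_fin.
    rewrite vM gtr0_norm// EFinM -(level_integralE v0 vM p0) ge0_muleDl ?mule_ge0//.
    by rewrite -EFinM [(M `^ _ * _)%R]mulrC -muleA [(level_integral _ _ _ * _)%E]muleC.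
(* equal to the logarithm almost everywhere, and nonnegative everywhere *)
pose L x : \bar R := if 0 <= v x <= M then lne (M%:E / (v x)%:E) else 0%E.
have L0 x : (0 <= L x)%E.
  rewrite /L; case: ifP => // /andP[]; rewrite le_eqVlt => /predU1P[<- _|v0 vM].
    by rewrite inve0 gt0_muley ?lte_fin//= leey.
  rewrite lne_div_gt0// lee_fin ln_ge0//.
  by rewrite ler_pdivlMr// mul1r.
have mlne : measurable_fun setT (fun x => lne (M%:E / (v x)%:E)%E).
  exact: (measurableT_comp (measurable_lne_div M_gt0) mv).
have mL : measurable_fun setT L.
  apply: measurable_fun_ifT => //; apply: measurable_and; exact: measurable_fun_ler.
have LE : (\int[@lebesgue_rV R N]_(x in Y) L x =
    \int[@lebesgue_rV R N]_(x in Y) lne (M%:E / (u x)%:E))%E.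
  rewrite [RHS](eq_integral (fun x => lne (M%:E / (v x)%:E)%E)); last first.
    by move=> x /set_mem xy; rewrite vE//; exact: cubeE.
  apply: ae_eq_integral => //; [exact: measurable_funTS|exact: measurable_funTS|].
  apply: filterS u_bounded => x ux /cubeE Ex; rewrite /L vE//.
  by rewrite ux.
have upper : (\int[@lebesgue_rV R N]_(x in Y) (p%:E * excess_integral M p (v x) +
     (Num.max (M - v x) 0 `^ p * M `^ (- p))%:E) <=
    \int[@lebesgue_rV R N]_(x in Y) (p%:E * L x))%E.
  apply: ae_ge0_le_integral => //.
  - by move=> x _; rewrite adde_ge0 ?mule_ge0// lee_fin mulr_ge0 ?powR_ge0.
  - apply: measurable_funTS; apply: emeasurable_funD.
      exact: measurable_funeM.
    apply/measurable_EFinP; apply: measurable_funM => //.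
    apply: (measurableT_comp (measurable_powR p)); apply: measurable_maxr => //.
    exact: measurable_funB.
  - by move=> x _; rewrite mule_ge0.
  - by apply: measurable_funTS; exact: measurable_funeM.
  - apply: filterS u_bounded => x ux /cubeE Ex; have := ux Ex.
    rewrite -(vE x Ex) /L => vM; rewrite vM; case/andP: vM => v0 vM.
    exact: excess_integral_le.
apply: le_trans lower _; apply: le_trans main _.
rewrite -LE (_ : gamma * p / (r - rho) `^ p = C * p); last by rewrite /C mulrAC.
rewrite [(C * p)%:E]EFinM -muleA lee_wpmul2l ?lee_fin//; apply: le_trans upper _.
by rewrite ge0_integralZl//; exact: measurable_funTS mL.
Qed.
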